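(* Let $(A,\mathfrak m)$ be a complete equicharacteristic Gorenstein local ring which is an isolated singularity, with algebraically closed residue field, and assume that $A$ is not of finite (Cohen-Macaulay) representation type. Let $\mathcal C$ be a connected component of the stable AR-quiver $\underline\Gamma(A)$. For $[M]\in\mathcal C$ set $I(M)=\{n\in\mathbb Z\mid[\operatorname{Syz}_n(M)]\in\mathcal C\}$. Then: (1) $I(M)$ is an ideal of $\mathbb Z$ (possibly zero); (2) $I(N)=I(M)$ for all $[N]\in\mathcal C$.
   Context: All rings are commutative Noetherian local, all modules finitely generated. $A$ is an isolated singularity if $A_P$ is regular for every prime $P\neq\mathfrak m$ (Artinian rings are allowed). $A$ is of finite representation type if there are only finitely many isomorphism classes of indecomposable maximal Cohen-Macaulay (MCM) $A$-modules. AR-quiver $\Gamma(A)$: the vertices are the isomorphism classes $[M]$ of indecomposable MCM $A$-modules, and the number of arrows from $[M]$ to $[N]$ is $\operatorname{irr}(M,N)=\dim_k (M,N)_1/(M,N)_2$ ($k=A/\mathfrak m$), where $(M,N)_1$ is the set of non-isomorphisms $M\to N$ and $(M,N)_2$ is the set of maps factoring as $M\xrightarrow{u}X\xrightarrow{v}N$ with $X$ MCM, $u$ not a split monomorphism and $v$ not a split epimorphism. The stable AR-quiver $\underline\Gamma(A)$ is obtained by deleting the vertex $[A]$ and all arrows to or from it. Connected components are those of the underlying undirected graph. For $n\ge0$, $\operatorname{Syz}_n(M)$ is the $n$-th syzygy in a minimal free resolution of $M$ ($\operatorname{Syz}_0(M)=M$). For $n\le-1$ and $M$ MCM without free summands,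 $\operatorname{Syz}_n(M)$ is the $(-n)$-th minimal cosyzygy, i.e. $\operatorname{Syz}_n(M)=(\operatorname{Syz}_{-n}(M^* ))^*$ with $(-)^*=\operatorname{Hom}_A(-,A)$. For each $n\in\mathbb Z$, $\operatorname{Syz}_n$ sends indecomposable non-free MCM modules to indecomposable non-free MCM modules. *)

(* Defs.v *)
From HB Require Import structures.
From Stdlib Require Import Relation_Operators.
From mathcomp Require Import all_boot all_order all_algebra.
From mathcomp Require Import boolp classical_sets.

Set Implicit Arguments.
Unset Strict Implicit.
Unset Printing Implicit Defensive.

Import GRing.Theory.
Local Open Scope classical_set_scope.
Local Open Scope ring_scope.

(** * Ideals and local rings *)

Section Ideals.
Variable R : comNzRingType.
Implicit Types (I J P : set R) (n : nat).

Definition is_ideal I : Prop :=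
  [/\ I 0, forall x y, I x -> I y -> I (x + y) & forall a x, I x -> I (a * x)].

Definition proper_ideal I : Prop := is_ideal I /\ ~ I 1.

Definition prime_ideal P : Prop :=
  proper_ideal P /\ forall x y, P (x * y) -> P x \/ P y.

Definition maximal_ideal I : Prop :=
  proper_ideal I /\ forall J, proper_ideal J -> I `<=` J -> J = I.

Definition ideal_span (S : set R) : set R :=
  [set a | exists n (c x : 'I_n -> R),
     (forall i, S (x i)) /\ a = \sum_i c i * x i].

Fixpoint ideal_pow I n : set R :=
  if n is n'.+1 then
    ideal_span [set a | exists x y, [/\ I x, ideal_pow I n' y & a = x * y]]
  else setT.

Definition noetherian : Prop :=
  forall I, is_ideal I -> exists n (x : 'I_n -> R), I = ideal_span (range x).

Definition local_ring (m : set R) : Prop :=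
  maximal_ideal m /\ forall J, maximal_ideal J -> J = m.

(* Bijectivity of the canonical map R -> lim R/I^n; an element of the limit
   is given by a sequence u of representatives. *)
Definition adically_complete I : Prop :=
  (forall a, (forall n, ideal_pow I n a) -> a = 0) /\
  (forall u : nat -> R, (forall n, ideal_pow I n (u n.+1 - u n)) ->
     exists l, forall n, ideal_pow I n (l - u n)).

Definition prime_chain n (P : 'I_n.+1 -> set R) : Prop :=
  (forall i, prime_ideal (P i)) /\
  (forall i j : 'I_n.+1, (i < j)%N -> P i `<` P j).

Definition krull_dim d : Prop :=
  (exists P : 'I_d.+1 -> set R, prime_chain P) /\
  (forall n (P : 'I_n.+1 -> set R), prime_chain P -> (n <= d)%N).

Definition residue_field (m : set R) (k : fieldType) (pi : {rmorphism R -> k}) :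
    Prop :=
  (forall y, exists x, pi x = y) /\ (forall x, pi x = 0 <-> m x).

(* Equality of the characteristics of R and of its residue field. *)
Definition equicharacteristic (k : fieldType) : Prop :=
  forall n, n%:R = 0 :> R <-> n%:R = 0 :> k.

End Ideals.

Definition regular_local_ring (R : comNzRingType) : Prop :=
  noetherian R /\ exists m : set R, local_ring m /\
  exists d, krull_dim R d /\ exists x : 'I_d -> R, m = ideal_span (range x).

(* The ring morphism phi : R -> S exhibits S as the localization of R at P. *)
Definition is_localization (R S : comNzRingType) (P : set R)
    (phi : {rmorphism R -> S}) : Prop :=
  [/\ forall s, ~ P s -> exists t, t * phi s = 1,
      forall y, exists a s, ~ P s /\ y * phi s = phi a &
      forall a, phi a = 0 <-> exists s, ~ P s /\ s * a = 0].

Definition isolated_singularity (R : comNzRingType) (m : set R) : Prop :=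
  forall P : set R, prime_ideal P -> P <> m ->
  exists (S : comNzRingType) (phi : {rmorphism R -> S}),
    is_localization P phi /\ regular_local_ring S.

(** * Modules *)

Definition LinHom (A : comNzRingType) (M N : lmodType A) := {linear M -> N}.

Section LinHomModule.
Variables (A : comNzRingType) (M N : lmodType A).
Implicit Types f g h : LinHom M N.

Lemma LinHom_ext f g : (forall x, f x = g x) -> f = g.
Proof.
move=> fg; have : (f : M -> N) = g by apply: funext.
case: f g {fg} => [f [[fa] [fb]]] [g [[ga] [gb]]] /= e; subst g.
by congr (GRing.Linear.Pack (GRing.Linear.Class _ _)); congr (_ _);
   apply: Prop_irrelevance.
Qed.

HB.instance Definition _ := gen_eqMixin (LinHom M N).
HB.instance Definition _ := gen_choiceMixin (LinHom M N).

Definition LinHom_zero : LinHom M N := (\0 : M -> N).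
Definition LinHom_add f g : LinHom M N := (f \+ g : M -> N).
Definition LinHom_opp f : LinHom M N := (\- f : M -> N).
Definition LinHom_scale (a : A) f : LinHom M N := (a \*: f : M -> N).

Fact LinHom_addA : associative LinHom_add.
Proof. by move=> f g h; apply: LinHom_ext => x /=; rewrite addrA. Qed.
Fact LinHom_addC : commutative LinHom_add.
Proof. by move=> f g; apply: LinHom_ext => x /=; rewrite addrC. Qed.
Fact LinHom_add0 : left_id LinHom_zero LinHom_add.
Proof. by move=> f; apply: LinHom_ext => x /=; rewrite add0r. Qed.
Fact LinHom_addN : left_inverse LinHom_zero LinHom_opp LinHom_add.
Proof. by move=> f; apply: LinHom_ext => x /=; rewrite addNr. Qed.

HB.instance Definition _ :=
  GRing.isZmodule.Build (LinHom M N)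
    LinHom_addA LinHom_addC LinHom_add0 LinHom_addN.

Fact LinHom_scaleA a b f :
  LinHom_scale a (LinHom_scale b f) = LinHom_scale (a * b) f.
Proof. by apply: LinHom_ext => x /=; rewrite scalerA. Qed.
Fact LinHom_scale1 : left_id 1 LinHom_scale.
Proof. by move=> f; apply: LinHom_ext => x /=; rewrite scale1r. Qed.
Fact LinHom_scaleDr : right_distributive LinHom_scale +%R.
Proof. by move=> a f g; apply: LinHom_ext => x /=; rewrite scalerDr. Qed.
Fact LinHom_scaleDl f : {morph LinHom_scale^~ f : a b / a + b}.
Proof. by move=> a b; apply: LinHom_ext => x /=; rewrite scalerDl. Qed.

HB.instance Definition _ := GRing.Zmodule_isLmodule.Build A (LinHom M N)
  LinHom_scaleA LinHom_scale1 LinHom_scaleDr LinHom_scaleDl.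

End LinHomModule.

Section Modules.
Variable A : comNzRingType.
Implicit Types (m : set A) (M N X E C : lmodType A).

Definition dual M : lmodType A := LinHom M (A^o : lmodType A).

Definition isomorphic M N : Prop := exists f : LinHom M N, bijective f.

Definition finitely_generated M : Prop :=
  exists n (x : 'I_n -> M), forall y, exists a : 'I_n -> A,
    y = \sum_i a i *: x i.

Definition indecomposable M : Prop :=
  (exists x : M, x <> 0) /\
  forall U V : lmodType A, isomorphic M (U * V)%type ->
    (forall u : U, u = 0) \/ (forall v : V, v = 0).

Definition injective_module E : Prop :=
  forall (U V : lmodType A) (i : LinHom U V) (f : LinHom U E),
    injective i -> exists g : LinHom V E, forall u, g (i u) = f u.

(* M has an injective resolution of length n, cut into short exact
   sequences. *)
Fixpoint inj_dim_le n M : Prop :=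
  if n is n'.+1 then
    exists (E C : lmodType A) (i : LinHom M E) (p : LinHom E C),
      [/\ injective_module E, injective i, forall z, exists y, p y = z,
          forall y, p y = 0 <-> exists x, y = i x & inj_dim_le n' C]
  else injective_module M.

(* y \in (x_j | j < i) M *)
Definition in_ideal_mul M n (x : 'I_n -> A) (i : nat) (y : M) : Prop :=
  exists z : 'I_n -> M, y = \sum_(j < n | (j < i)%N) x j *: z j.

Definition regular_sequence m M n (x : 'I_n -> A) : Prop :=
  [/\ forall i, m (x i),
      forall (i : 'I_n) (y : M),
        in_ideal_mul x i (x i *: y) -> in_ideal_mul x i y &
      exists y : M, ~ in_ideal_mul x n y].

Definition depth m M d : Prop :=
  (exists x : 'I_d -> A, regular_sequence m M x) /\
  (forall n (x : 'I_n -> A), regular_sequence m M x -> (n <= d)%N).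

Definition MCM m M : Prop :=
  finitely_generated M /\ exists d, krull_dim A d /\ depth m M d.

Definition indecomposable_MCM m M : Prop := MCM m M /\ indecomposable M.

Definition finite_representation_type m : Prop :=
  exists n (F : 'I_n -> lmodType A), forall M, indecomposable_MCM m M ->
    exists i, isomorphic M (F i).

(** ** Syzygies *)

(* The free modules are modules of row vectors, on which a matrix acts by
   right multiplication. *)
Record min_free_res m M := MinFreeRes {
  betti : nat -> nat;
  res_diff : forall i, 'M[A]_(betti i.+1, betti i);
  aug : LinHom 'rV[A]_(betti 0) M;
  aug_surj : forall y, exists v, aug v = y;
  aug_exact : forall v, aug v = 0 <-> exists u, v = u *m res_diff 0;
  res_exact : forall i (v : 'rV_(betti i.+1)),
    v *m res_diff i = 0 <-> exists u, v = u *m res_diff i.+1;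
  res_minimal : forall i r c, m (res_diff i r c) }.

(* N is isomorphic to the n-th syzygy of M, i.e. to M itself if n = 0, and
   otherwise to the image of the n-th differential of a minimal resolution. *)
Definition is_nat_syz m (n : nat) M N : Prop :=
  if n is i.+1 then
    exists (F : min_free_res m M) (f : LinHom N 'rV[A]_(betti F i)),
      injective f /\
      forall v, (exists y, v = f y) <-> (exists u, v = u *m res_diff F i)
  else isomorphic M N.

(* [Negz i] is the integer [- i.+1]. *)
Definition is_syz m (n : int) M N : Prop :=
  match n with
  | Posz i => is_nat_syz m i M N
  | Negz i => exists K, is_nat_syz m i.+1 (dual M) K /\ isomorphic N (dual K)
  end.

(** ** Irreducible maps *)

Definition split_mono M N (u : LinHom M N) : Prop :=
  exists r : LinHom N M, forall x, r (u x) = x.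

Definition split_epi M N (v : LinHom M N) : Prop :=
  exists s : LinHom N M, forall y, v (s y) = y.

(* f lies in (M,N)_1 *)
Definition hom1 M N (f : LinHom M N) : Prop := ~ bijective f.

(* f lies in (M,N)_2 *)
Definition hom2 m M N (f : LinHom M N) : Prop :=
  exists X (u : LinHom M X) (v : LinHom X N),
    [/\ MCM m X, ~ split_mono u, ~ split_epi v & forall x, f x = v (u x)].

(* dim_k (M,N)_1 / (M,N)_2 = n, where k = A/m: the classes of f_0 .. f_(n-1)
   form a k-basis; scalars in k are given by representatives in A. *)
Definition irr_dim m M N n : Prop :=
  exists f : 'I_n -> LinHom M N,
    [/\ forall i, hom1 (f i),
        forall g, hom1 g ->
          exists a : 'I_n -> A, hom2 m (g - \sum_i a i *: f i) &
        forall a : 'I_n -> A, hom2 m (\sum_i a i *: f i) -> forall i, m (a i)].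

End Modules.

(** * Quivers *)

Record quiver := Quiver {
  vertex : Type;
  narrows : vertex -> vertex -> nat }.

Definition delete_vertices (Q : quiver) (D : vertex Q -> Prop) : quiver :=
  {| vertex := {v : vertex Q | ~ D v};
     narrows := fun v w => narrows (sval v) (sval w) |}.

Definition connected_component (Q : quiver) (C : vertex Q -> Prop) : Prop :=
  exists v, forall w,
    C w <-> clos_refl_sym_trans _ (fun x y => (0 < narrows x y)%N) v w.

Section AuslanderReiten.
Variables (A : comNzRingType) (m : set A).
Implicit Types M N : lmodType A.

Definition iso_class M : lmodType A -> Prop := fun N => isomorphic M N.

Definition AR_vertex :=
  {v : lmodType A -> Prop |
    exists M, indecomposable_MCM m M /\ v = iso_class M}.

(* irr(M,N) depends only on the classes of M and N, and is finite for
   finitely generated M and N over a Noetherian ring, so that the default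
   value 0 of xget is irrelevant. *)
Definition AR_narrows (v w : AR_vertex) : nat :=
  xget 0%N [set n | exists M N, [/\ sval v M, sval w N & irr_dim m M N n]].

Definition AR_quiver : quiver := Quiver AR_narrows.

Definition stable_AR_quiver : quiver :=
  delete_vertices
    (fun v : vertex AR_quiver => sval v = iso_class (A^o : lmodType A)).

Implicit Types C : vertex stable_AR_quiver -> Prop.

(* [M] \in C *)
Definition in_component C M : Prop :=
  exists v, C v /\ sval (sval v) = iso_class M.

Definition syz_index C M : set int :=
  [set n | exists N, is_syz m n M N /\ in_component C N].

End AuslanderReiten.

Definition gorenstein_local_ring (A : comNzRingType) (m : set A) : Prop :=
  [/\ noetherian A, local_ring m & exists n, inj_dim_le n (A^o : lmodType A)].

(* Main.v *)
From HB Require Import structures.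
Require Import Defs.
From Stdlib Require Import Relation_Operators.
From mathcomp Require Import all_boot all_order all_algebra.
From mathcomp Require Import boolp classical_sets.

Set Implicit Arguments.
Unset Strict Implicit.
Unset Printing Implicit Defensive.

Import GRing.Theory.
Local Open Scope classical_set_scope.
Local Open Scope ring_scope.

(** Taking syzygies is an automorphism of the stable quiver, so it permutes the
    connected components; the integers [n] whose power of this automorphism fixes a
    given component form a subgroup of the integers, and every vertex of the
    component yields the same subgroup.

    That the syzygy operator respects arrows is the stable equivalence induced by
    syzygies. Let [N], [N'] be the syzygies of [M], [M']. Every map [M -> M'] induces
    a map [N -> N'] and, because [Ext^1(M,A) = 0], every map [N -> N'] arises in this
    way; both choices are unique up to maps through free modules ([compatible]). A map
    through a free module from a module without free summand has image in [m] times
    its target, so adding it to the identity gives an isomorphism ([id_mod_max_bij]).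
    This shows that isomorphisms, split monomorphisms and split epimorphisms
    correspond, and with them the maps in [(M,M')_1] and [(M,M')_2], where a map through
    a free module is absorbed by adding that module to the middle term
    ([hom2_add_free]). Hence [irr(M,M') = irr(N,N')] ([irr_dim_syz]).

    It remains to know that maximal Cohen-Macaulay modules are the modules [M] with
    [Ext^j(M,A) = 0] for [j > 0], that this class is closed under duals and syzygies,
    and that its members are reflexive. Ext is handled through a coresolution of [A]
    by injective modules, where vanishing of [Ext^j] means that maps into the [j]-th
    cosyzygy lift to the injective module before it. If [s] is the injective dimension
    of [A], then Ext in degree [s] does not vanish on the residue field, and vanishes on
    the quotient of [A] by a regular sequence of length less than [s]
    and then on all submodules of this quotient; so the quotient contains no copy of
    the residue field and the sequence can be prolonged by prime avoidance
    ([regular_sequence_exists]). Thus [A] has a regular sequence of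
    length [s]; it stays regular on duals of modules with vanishing Ext, which are
    syzygies of arbitrarily high order, and a module with a regular sequence of length
    [s] has vanishing Ext. Reflexivity follows by dualizing a presentation twice
    ([acyclic_reflexive]). Finally a regular sequence gives a chain of primes
    ([regular_sequence_dim]), so [s] is at most the dimension, and a maximal
    Cohen-Macaulay module forces equality ([MCM_acyclic]). *)

(** * Linear maps and quotient modules *)

Section LinearMaps.
Variable A : comNzRingType.
Implicit Types M N P : lmodType A.

Definition lin_of M N (f : M -> N) (fl : linear f) : LinHom M N :=
  HB.pack f (GRing.isLinear.Build A M N *:%R f fl).

Lemma lin_exists M N (f : M -> N) :
  linear f -> exists g : LinHom M N, forall x, g x = f x.
Proof. by move=> fl; exists (lin_of fl). Qed.

Definition lin_comp M N P (g : LinHom N P) (f : LinHom M N) : LinHom M P :=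
  (g \o f : M -> P).
Definition lin_id M : LinHom M M := (idfun : M -> M).

Definition surj M N (f : M -> N) : Prop := forall y, exists x, f x = y.

Lemma bij_inj_surj M N (f : LinHom M N) : injective f -> surj f -> bijective f.
Proof.
move=> fi /choice[g gK]; exists g => // x.
by apply: fi; rewrite gK.
Qed.

Lemma bij_surj M N (f : LinHom M N) : bijective f -> surj f.
Proof. by case=> g _ gK y; exists (g y). Qed.

Lemma ker0_inj M N (f : LinHom M N) : (forall x, f x = 0 -> x = 0) -> injective f.
Proof.
move=> f0 x y e; apply/eqP; rewrite -subr_eq0; apply/eqP/f0.
by rewrite linearB e subrr.
Qed.

Lemma inj_ker0 M N (f : LinHom M N) x : injective f -> f x = 0 -> x = 0.
Proof. by move=> fi; rewrite -(linear0 f) => /fi. Qed.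

Lemma bij_inverse M N (f : LinHom M N) : bijective f ->
  exists g : LinHom N M, cancel f g /\ cancel g f.
Proof.
case=> g fK gK.
have gl : linear g by move=> a x y; rewrite -[RHS]fK linearP !gK.
by exists (lin_of gl).
Qed.

Lemma factor_surj M N P (f : LinHom M N) (g : LinHom M P) :
  surj f -> (forall x, f x = 0 -> g x = 0) ->
  exists h : LinHom N P, forall x, h (f x) = g x.
Proof.
move=> /choice[s sK] fg.
have gs x y : f x = f y -> g x = g y.
  move=> e; apply/eqP; rewrite -subr_eq0 -linearB; apply/eqP/fg.
  by rewrite linearB e subrr.
have hl : linear (g \o s).
  by move=> a x y; rewrite /= -linearP; apply: gs; rewrite linearP !sK.
by exists (lin_of hl) => x /=; apply: gs; rewrite sK.
Qed.

Lemma factor_inj M N P (i : LinHom N P) (g : LinHom M P) :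
  injective i -> (forall x, exists y, g x = i y) ->
  exists h : LinHom M N, forall x, i (h x) = g x.
Proof.
move=> ii /choice[h hE].
have hl : linear h by move=> a x y; apply: ii; rewrite linearP -!hE linearP.
by exists (lin_of hl) => x /=; rewrite -hE.
Qed.

Lemma isomorphic_refl M : isomorphic M M.
Proof. by exists (lin_id M); exists idfun. Qed.

Lemma isomorphic_sym M N : isomorphic M N -> isomorphic N M.
Proof. by move=> [f /bij_inverse[g [fK gK]]]; exists g; exists f. Qed.

Lemma isomorphic_trans M N P : isomorphic M N -> isomorphic N P -> isomorphic M P.
Proof. by move=> [f fb] [g gb]; exists (lin_comp g f); exact: bij_comp gb fb. Qed.

(** ** Free modules of row vectors *)

Lemma row_lin n M (x : 'I_n -> M) :
  exists f : LinHom 'rV[A]_n M, forall v, f v = \sum_j v 0 j *: x j.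
Proof.
apply: lin_exists => a u v; rewrite scaler_sumr -big_split /=.
by apply: eq_bigr => j _; rewrite !mxE scalerDl scalerA.
Qed.

Lemma row_lin_delta n M (x : 'I_n -> M) :
  exists f : LinHom 'rV[A]_n M, forall j, f (delta_mx 0 j) = x j.
Proof.
have [f fE] := row_lin x; exists f => j; rewrite fE (bigD1 j) //= !mxE !eqxx.
rewrite scale1r big1 ?addr0 // => l lj.
by rewrite !mxE (negPf lj) andbF scale0r.
Qed.

Lemma row_lin_sum n M (f : LinHom 'rV[A]_n M) v :
  f v = \sum_j v 0 j *: f (delta_mx 0 j).
Proof. by rewrite {1}[v]row_sum_delta linear_sum; apply: eq_bigr => j _; rewrite linearZ. Qed.

Lemma row_lin_ext n M (f g : LinHom 'rV[A]_n M) :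
  (forall j, f (delta_mx 0 j) = g (delta_mx 0 j)) -> forall v, f v = g v.
Proof.
by move=> e v; rewrite row_lin_sum [RHS]row_lin_sum; apply: eq_bigr => j _; rewrite e.
Qed.

Lemma lift_free n M N (p : LinHom M N) (g : LinHom 'rV[A]_n N) :
  (forall j, exists x, p x = g (delta_mx 0 j)) ->
  exists h : LinHom 'rV[A]_n M, forall v, p (h v) = g v.
Proof.
move=> /choice[x xE]; have [h hE] := row_lin_delta x; exists h.
by apply: (row_lin_ext (f := lin_comp p h)) => j /=; rewrite hE xE.
Qed.

End LinearMaps.

(** ** Quotients *)

Definition submod (A : comNzRingType) (M : lmodType A) (U : set M) : Prop :=
  [/\ U 0, forall x y, U x -> U y -> U (x + y) & forall a x, U x -> U (a *: x)].

Section SubmodTheory.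
Variables (A : comNzRingType) (M : lmodType A) (U : set M).
Hypothesis Us : submod U.

Lemma submod0 : U 0. Proof. by case: Us. Qed.
Lemma submodD x y : U x -> U y -> U (x + y). Proof. by case: Us => _ + _; apply. Qed.
Lemma submodZ a x : U x -> U (a *: x). Proof. by case: Us => _ _; apply. Qed.
Lemma submodN x : U x -> U (- x). Proof. by rewrite -scaleN1r; apply: submodZ. Qed.
Lemma submodB x y : U x -> U y -> U (x - y).
Proof. by move=> Ux Uy; apply: submodD => //; apply: submodN. Qed.
Lemma submod_sum (I : Type) (r : seq I) (Q : pred I) (F : I -> M) :
  (forall i, Q i -> U (F i)) -> U (\sum_(i <- r | Q i) F i).
Proof. by move=> UF; elim/big_ind: _ => //; [apply: submod0 | apply: submodD]. Qed.

End SubmodTheory.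

Section Quotient.
Variables (A : comNzRingType) (M : lmodType A) (U : set M).

(** The argument [submod U] is a parameter so that the operations on the cosets,
    which need it, can be attached to this type. *)
Definition quot of submod U : Type := {c : set M | exists x, c = [set y | U (x - y)]}.

Hypothesis Us : submod U.
Local Notation Q := (quot Us).

HB.instance Definition _ := gen_eqMixin Q.
HB.instance Definition _ := gen_choiceMixin Q.

Definition quot_class (x : M) : Q := exist _ _ (ex_intro _ x erefl).
Definition quot_repr (c : Q) : M := sval (cid (svalP c)).

Lemma quot_classP x y : quot_class x = quot_class y <-> U (x - y).
Proof.
split=> [/(congr1 sval) /= e|Uxy].
  have : [set z | U (y - z)] y by rewrite /= subrr; apply: submod0.
  by rewrite -e.
apply: eq_exist => /=; apply/seteqP; split=> z /= Uz.
  by rewrite -(subrKA x) -opprB addrC; apply: submodB.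
by rewrite -(subrKA y); apply: submodD.
Qed.

Lemma quot_reprK c : quot_class (quot_repr c) = c.
Proof.
case: c => c cP; apply: eq_exist => /=.
by rewrite /quot_repr /=; case: cid => x /= ->.
Qed.

Lemma quot_class_repr x : U (quot_repr (quot_class x) - x).
Proof. by apply/quot_classP; rewrite quot_reprK. Qed.

Definition quot_add c d : Q := quot_class (quot_repr c + quot_repr d).
Definition quot_opp c : Q := quot_class (- quot_repr c).
Definition quot_scale (a : A) c : Q := quot_class (a *: quot_repr c).

Lemma quot_addE x y : quot_add (quot_class x) (quot_class y) = quot_class (x + y).
Proof.
apply/quot_classP; rewrite opprD addrACA.
by apply: submodD => //; apply: quot_class_repr.
Qed.
Lemma quot_oppE x : quot_opp (quot_class x) = quot_class (- x).
Proof. by apply/quot_classP; rewrite -opprD; apply: submodN => //; apply: quot_class_repr. Qed.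
Lemma quot_scaleE a x : quot_scale a (quot_class x) = quot_class (a *: x).
Proof. by apply/quot_classP; rewrite -scalerBr; apply: submodZ => //; apply: quot_class_repr. Qed.

Fact quot_addA : associative quot_add.
Proof.
move=> c d e; rewrite -[c]quot_reprK -[d]quot_reprK -[e]quot_reprK.
by rewrite !quot_addE addrA.
Qed.
Fact quot_addC : commutative quot_add.
Proof. by move=> c d; rewrite /quot_add addrC. Qed.
Fact quot_add0 : left_id (quot_class 0) quot_add.
Proof. by move=> c; rewrite -[c]quot_reprK quot_addE add0r. Qed.
Fact quot_addN : left_inverse (quot_class 0) quot_opp quot_add.
Proof. by move=> c; rewrite -[c]quot_reprK quot_oppE quot_addE addNr. Qed.
HB.instance Definition _ :=
  GRing.isZmodule.Build Q quot_addA quot_addC quot_add0 quot_addN.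

Fact quot_scaleA a b c : quot_scale a (quot_scale b c) = quot_scale (a * b) c.
Proof. by rewrite -[c]quot_reprK !quot_scaleE scalerA. Qed.
Fact quot_scale1 : left_id 1 quot_scale.
Proof. by move=> c; rewrite -[c]quot_reprK quot_scaleE scale1r. Qed.
Fact quot_scaleDr : right_distributive quot_scale +%R.
Proof.
move=> a c d; rewrite -[c]quot_reprK -[d]quot_reprK.
by rewrite [_ + _]quot_addE !quot_scaleE [RHS]quot_addE scalerDr.
Qed.
Fact quot_scaleDl c : {morph quot_scale^~ c : a b / a + b}.
Proof.
by move=> a b; rewrite -[c]quot_reprK !quot_scaleE [RHS]quot_addE scalerDl.
Qed.
HB.instance Definition _ := GRing.Zmodule_isLmodule.Build A Q
  quot_scaleA quot_scale1 quot_scaleDr quot_scaleDl.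

(** All that is used of quotients; submodules too are obtained from it, as
    quotients of free modules. *)
Lemma quotient_exists :
  exists (Q : lmodType A) (p : LinHom M Q), surj p /\ forall x, p x = 0 <-> U x.
Proof.
have pl : linear quot_class.
  move=> a x y; have -> : a *: quot_class x = quot_class (a *: x) := quot_scaleE a x.
  exact: esym (quot_addE _ _).
exists Q, (lin_of pl); split=> [c|x]; first by exists (quot_repr c); apply: quot_reprK.
by rewrite -[x in U x]subr0; apply: quot_classP.
Qed.

End Quotient.

(** * Noetherian modules *)

Section Noetherian.
Variable A : comNzRingType.
Implicit Types M N : lmodType A.

Definition noeth_mod M : Prop := forall U : set M, submod U ->
  exists n (g : LinHom 'rV[A]_n M), forall y, U y <-> exists v, g v = y.

Lemma submod_ker M N (f : LinHom M N) : submod [set x | f x = 0].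
Proof.
split=> /= [|x y fx fy|a x fx]; first by rewrite linear0.
  by rewrite linearD fx fy addr0.
by rewrite linearZ /= fx scaler0.
Qed.

Lemma submod_im M N (f : LinHom M N) : submod [set y | exists x, f x = y].
Proof.
split=> /= [|_ _ [x <-] [y <-]|a _ [x <-]]; first by exists 0; rewrite linear0.
  by exists (x + y); rewrite linearD.
by exists (a *: x); rewrite linearZ.
Qed.

Lemma submod_preim M N (f : LinHom M N) (U : set N) :
  submod U -> submod [set x | U (f x)].
Proof.
move=> Us; split=> /= [|x y Ux Uy|a x Ux]; first by rewrite linear0; apply: submod0.
  by rewrite linearD; apply: submodD.
by rewrite linearZ; apply: submodZ.
Qed.

Lemma submod_imset M N (f : LinHom M N) (U : set M) :
  submod U -> submod [set y | exists2 x, U x & f x = y].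
Proof.
move=> Us; split=> /= [|_ _ [x Ux <-] [y Uy <-]|a _ [x Ux <-]].
- by exists 0; rewrite ?linear0 //; apply: submod0.
- by exists (x + y); rewrite ?linearD //; apply: submodD.
- by exists (a *: x); rewrite ?linearZ //; apply: submodZ.
Qed.

Lemma finitely_generatedP M :
  finitely_generated M <-> exists n (g : LinHom 'rV[A]_n M), surj g.
Proof.
split=> [[n [x xg]]|[n [g gs]]]; exists n.
  have [g gE] := row_lin x; exists g => y; have [a ->] := xg y.
  by exists (\row_j a j); rewrite gE; apply: eq_bigr => j _; rewrite mxE.
exists (fun j => g (delta_mx 0 j)) => y; have [v <-] := gs y.
by exists (v 0); apply: row_lin_sum.
Qed.

Lemma fg_row n : finitely_generated ('rV[A]_n : lmodType A).
Proof. by apply/finitely_generatedP; exists n, (lin_id _) => y; exists y. Qed.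

Lemma fg_surj M N (f : LinHom M N) :
  surj f -> finitely_generated M -> finitely_generated N.
Proof.
move=> fs /finitely_generatedP[n [g gs]]; apply/finitely_generatedP.
exists n, (lin_comp f g) => y; have [x <-] := fs y; have [v <-] := gs x.
by exists v.
Qed.

Lemma fg_iso M N : isomorphic M N -> finitely_generated M -> finitely_generated N.
Proof. by move=> [f /bij_surj fs]; apply: fg_surj fs. Qed.

Lemma row_lin_cat n k M (g : LinHom 'rV[A]_n M) (h : LinHom 'rV[A]_k M) :
  exists f : LinHom 'rV[A]_(n + k) M, forall v, f v = g (lsubmx v) + h (rsubmx v).
Proof.
apply: lin_exists => a u v.
have -> : lsubmx (a *: u + v) = a *: lsubmx u + lsubmx v.
  by apply/matrixP => i j; rewrite !mxE.
have -> : rsubmx (a *: u + v) = a *: rsubmx u + rsubmx v.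
  by apply/matrixP => i j; rewrite !mxE.
by rewrite !linearP scalerDr addrACA.
Qed.

(** Lifts of generators of the image of [U] in [M''], with generators of
    the trace of [U] on [M'], generate [U]. *)
Lemma noeth_mod_ext M' M M'' (i : LinHom M' M) (p : LinHom M M'') :
  (forall x, p x = 0 -> exists y, x = i y) ->
  noeth_mod M' -> noeth_mod M'' -> noeth_mod M.
Proof.
move=> ker_p noethM' noethM'' U Us.
have [n [g gU]] := noethM'' _ (submod_imset p Us).
have [k [h hU]] := noethM' _ (submod_preim i Us).
have /choice[u uE] j : exists x, U x /\ p x = g (delta_mx 0 j).
  have /gU[x Ux <-] : exists v, g v = g (delta_mx 0 j) by exists (delta_mx 0 j).
  by exists x.
have [g' g'E] := row_lin_delta u.
have pg' v : p (g' v) = g v.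
  by apply: (row_lin_ext (f := lin_comp p g')) => j /=; rewrite g'E; case: (uE j).
have Ug' v : U (g' v).
  rewrite row_lin_sum; apply: submod_sum => // j _; apply: submodZ => //.
  by rewrite g'E; case: (uE j).
have [f fE] := row_lin_cat g' (lin_comp i h); exists (n + k)%N, f => y; split.
  move=> Uy; have /gU[v gv] : exists2 x, U x & p x = p y by exists y.
  have [|z zE] := ker_p (y - g' v); first by rewrite linearB pg' gv subrr.
  have /hU[w hw] : U (i z) by rewrite -zE; apply: submodB.
  by exists (row_mx v w); rewrite fE row_mxKl row_mxKr /= hw -zE subrKC.
move=> [v <-]; rewrite fE; apply: submodD => //=.
by have: (exists w, h w = h (rsubmx v)) by [exists (rsubmx v)]; move/hU.
Qed.

Lemma noeth_mod_surj M N (f : LinHom M N) : surj f -> noeth_mod M -> noeth_mod N.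
Proof.
move=> fs noethM U Us; have [n [g gU]] := noethM _ (submod_preim f Us).
exists n, (lin_comp f g) => y; split=> [Uy|[v <-]].
  have [x xE] := fs y; have /gU[v gv] : U (f x) by rewrite xE.
  by exists v; rewrite /= gv xE.
by have: (exists w, g w = g v) by [exists v]; move/gU.
Qed.

Hypothesis noethA : noetherian A.

Lemma noeth_mod_ring : noeth_mod (A^o : lmodType A).
Proof.
move=> U Us; have [|n [x UE]] := noethA (I := U); first by case: Us.
have [g gE] := row_lin (M := A^o) x; exists n, g => y; split=> [|[v <-]].
  rewrite UE => -[k [c [z [zx ->]]]].
  apply: (submod_sum (M := A^o) (submod_im g)) => j _.
  apply: (submodZ (M := A^o) (submod_im g)).
  have [l _ <-] := zx j; exists (delta_mx 0 l).
  rewrite gE (bigD1 l) //= !mxE !eqxx scale1r big1 ?addr0 // => r rl.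
  by rewrite !mxE (negPf rl) andbF scale0r.
rewrite gE UE; exists n, (v 0), x; split=> // j; by exists j.
Qed.

Lemma noeth_mod_row n : noeth_mod ('rV[A]_n : lmodType A).
Proof.
elim: n => [|n IHn].
  move=> U Us; exists 0%N, 0 => y; rewrite (thinmx0 y).
  by split=> _; [exists 0 | apply: submod0].
have p_lin : linear (fun v : 'rV[A]_(1 + n) => v 0 (lshift n 0) : A^o).
  by move=> a u v; rewrite !mxE.
have i_lin : linear (fun v : 'rV[A]_n => row_mx (0 : 'rV_1) v).
  by move=> a u v; rewrite scale_row_mx add_row_mx scaler0 addr0.
apply: (@noeth_mod_ext _ _ _ (lin_of i_lin) (lin_of p_lin)) noeth_mod_ring => //= v v0.
exists (rsubmx v); rewrite -[v in LHS]hsubmxK; congr row_mx.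
by apply/rowP => j; rewrite !mxE ord1 v0.
Qed.

Lemma fg_noeth M : finitely_generated M -> noeth_mod M.
Proof.
by move=> /finitely_generatedP[n [g gs]]; apply: noeth_mod_surj gs (@noeth_mod_row n).
Qed.

Lemma fg_inj M N (i : LinHom M N) :
  injective i -> finitely_generated N -> finitely_generated M.
Proof.
move=> ii /fg_noeth/(_ _ (submod_im i))[n [g gi]].
have [v|h hE] := factor_inj (g := g) ii.
  have /gi[x <-] : exists w, g w = g v by exists v.
  by exists x.
apply/finitely_generatedP; exists n, h => x.
have /gi[v gv] : exists x', i x' = i x by exists x.
by exists v; apply: ii; rewrite hE.
Qed.

(** A submodule as a module of its own: the quotient of a free module by the kernel
    of a map onto the submodule. *)
Lemma submodule_exists M (U : set M) : finitely_generated M -> submod U ->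
  exists (K : lmodType A) (i : LinHom K M),
    [/\ injective i, finitely_generated K & forall x, U x <-> exists y, x = i y].
Proof.
move=> Mfg Us; have [n [g gU]] := fg_noeth Mfg Us.
have [K [p [ps pE]]] := quotient_exists (submod_ker g).
have [|i iE] := factor_surj (g := g) ps; first by move=> v /pE.
exists K, i; split=> [||x].
- apply: ker0_inj => y; have [v <-] := ps y.
  by rewrite iE => /pE.
- exact: fg_surj ps (fg_row n).
split=> [/gU[v <-]|[y ->]]; first by exists (p v); rewrite iE.
by have [v <-] := ps y; rewrite iE; apply/gU; exists v.
Qed.

Lemma noeth_acc M (W : nat -> set M) : noeth_mod M ->
  (forall k, submod (W k)) -> (forall k, W k `<=` W k.+1) ->
  exists K, forall k, W k `<=` W K.
Proof.
move=> noethM Ws Wle.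
have W_homo j k : (j <= k)%N -> W j `<=` W k.
  by move=> /subnKC <-; elim: (k - j)%N => [|l IH]; rewrite ?addn0 ?addnS // => x /IH/Wle.
have [|n [g gW]] := noethM [set x | exists k, W k x].
  split=> /= [|x y [j xj] [k yk]|a x [k xk]].
  - by exists 0%N; apply: submod0.
  - exists (maxn j k); apply: submodD => //; first exact: W_homo (leq_maxl _ _) _ xj.
    exact: W_homo (leq_maxr _ _) _ yk.
  - by exists k; apply: submodZ.
have /choice[k kE] j : exists k, W k (g (delta_mx 0 j)) by apply/gW; exists (delta_mx 0 j).
exists (\max_j k j) => l x xl; have /gW[v <-] : exists l, W l x by exists l.
rewrite row_lin_sum; apply: submod_sum => // j _; apply: submodZ => //.
exact: W_homo (leq_bigmax j) _ (kE j).
Qed.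

(** Without a maximal element one could choose a strictly increasing chain. *)
Lemma noeth_max M (Q : set M -> Prop) : noeth_mod M ->
  (exists U, submod U /\ Q U) ->
  exists U, [/\ submod U, Q U & forall V, submod V -> Q V -> U `<=` V -> V `<=` U].
Proof.
move=> noethM [U0 U0P]; apply: contrapT => no_max.
pose T := {U | submod U /\ Q U}.
have /choice[f fE] (U : T) : exists V : T, sval U `<=` sval V /\ ~ sval V `<=` sval U.
  apply: contrapT => /forallNP noV; apply: no_max; exists (sval U).
  have [Us UQ] := svalP U; split=> // V Vs VQ UV.
  by apply: contrapT => VU; apply: (noV (exist _ V (conj Vs VQ))).
pose W k : T := iter k f (exist _ U0 U0P).
have [|k|K WK] := noeth_acc (W := fun k => sval (W k)) noethM.
- by move=> k; case: (svalP (W k)).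
- by case: (fE (W k)).
- by have [_] := fE (W K); apply; apply: (WK K.+1).
Qed.

(** The kernels of the iterates of [f] stop growing at some [K]; an element of the
    kernel of [f] is some [f^K y], and then [y] is in the kernel of [f^(K+1)],
    hence of [f^K]. *)
Lemma surj_endo_bij M (f : LinHom M M) :
  finitely_generated M -> surj f -> bijective f.
Proof.
move=> Mfg fs; apply: bij_inj_surj => //; apply: ker0_inj => x fx0.
pose W k := [set y : M | iter k f y = 0].
have iter_lin k : linear (iter k f).
  by elim: k => [|k IH] a u v //=; rewrite (IH a u v) linearP.
have [|k|K WK] := noeth_acc (W := W) (fg_noeth Mfg).
- by move=> k; apply: (submod_ker (lin_of (iter_lin k))).
- by move=> y /=; rewrite /W /= => ->; rewrite linear0.
have iter_surj k : surj (iter k f).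
  by elim: k => [|k IH] y; [exists y | have [z <-] := fs y; have [w <-] := IH z; exists w].
have [y yE] := iter_surj K x; rewrite -yE; apply: (WK K.+1).
by rewrite /W /= yE.
Qed.

End Noetherian.

(** * Local rings and Nakayama's lemma *)

Lemma is_ideal_submod (A : comNzRingType) (I : set A) :
  is_ideal I <-> submod (I : set (A^o : lmodType A)).
Proof. by split; case. Qed.

Section MaxMul.
Variables (A : comNzRingType) (m : set A).
Implicit Types M N : lmodType A.

Definition max_ideal_mul M : set M :=
  [set x | exists n (a : 'I_n -> A) (z : 'I_n -> M),
     (forall j, m (a j)) /\ x = \sum_j a j *: z j].

Lemma max_ideal_mulZ M a (z : M) : m a -> max_ideal_mul (a *: z).
Proof.
by move=> ma; exists 1%N, (fun=> a), (fun=> z); rewrite big_ord1.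
Qed.

Lemma max_ideal_mul_lin M N (f : LinHom M N) x : max_ideal_mul x -> max_ideal_mul (f x).
Proof.
move=> [n [a [z [ma ->]]]]; exists n, a, (f \o z); split=> //.
by rewrite linear_sum; apply: eq_bigr => j _; rewrite linearZ.
Qed.

(** Over a local ring this says that [M] has no nonzero free direct summand: no
    linear form on [M] is onto, because its image is an ideal contained in [m]. *)
Definition no_free_quotient M : Prop :=
  forall (f : LinHom M (A^o : lmodType A)) x, m (f x).

Hypothesis m_ideal : is_ideal m.

Lemma submod_max_ideal_mul M : submod (@max_ideal_mul M).
Proof.
split=> [|_ _ [n [a [z [ma ->]]]] [k [b [w [mb ->]]]]|c _ [n [a [z [ma ->]]]]].
- by exists 0%N, (fun=> 0), (fun=> 0); split; [case|rewrite big_ord0].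
- pose cat T (f : 'I_n -> T) (g : 'I_k -> T) (j : 'I_(n + k)) :=
    match split j with inl i => f i | inr i => g i end.
  exists (n + k)%N, (cat _ a b), (cat _ z w); split.
    by move=> j; rewrite /cat; case: (fintype.split j) => i.
  rewrite big_split_ord /=; congr (_ + _); apply: eq_bigr => j _; rewrite /cat.
    by case: splitP => [i /= /val_inj -> //|i /= e]; have := ltn_ord j; rewrite e -ltn_subRL subnn.
  case: splitP => [i /= e|i /= /addnI/val_inj -> //].
  by have := ltn_ord i; rewrite -e -ltn_subRL subnn.
- exists n, (fun j => c * a j), z; split; first by move=> j; case: m_ideal => _ _; apply.
  by rewrite scaler_sumr; apply: eq_bigr => j _; rewrite scalerA.
Qed.

Lemma max_ideal_mul_row n (v : 'rV[A]_n) : max_ideal_mul v <-> forall j, m (v 0 j).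
Proof.
split=> [[k [a [z [ma ->]]]] j|mv].
  rewrite summxE; apply: (submod_sum (M := A^o)) => [|l _]; first exact/is_ideal_submod.
  by rewrite mxE mulrC; case: m_ideal => _ _; apply.
rewrite [v]row_sum_delta; apply: (submod_sum (@submod_max_ideal_mul _)) => j _.
exact: max_ideal_mulZ.
Qed.

Lemma no_free_quotient_row M n (f : LinHom M 'rV[A]_n) :
  no_free_quotient M -> forall x, max_ideal_mul (f x).
Proof.
move=> Mnf x; apply/max_ideal_mul_row => j.
have e_lin : linear (fun v : 'rV[A]_n => v 0 j : A^o) by move=> a u v; rewrite !mxE.
exact: (Mnf (lin_comp (lin_of e_lin) f)).
Qed.

Lemma no_free_quotient_surj M N (f : LinHom M N) :
  surj f -> no_free_quotient M -> no_free_quotient N.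
Proof. by move=> fs Mnf g y; have [x <-] := fs y; apply: (Mnf (lin_comp g f)). Qed.

Lemma no_free_quotient_iso M N :
  isomorphic M N -> no_free_quotient M -> no_free_quotient N.
Proof. by move=> [f /bij_surj]; apply: no_free_quotient_surj. Qed.

End MaxMul.

Section LocalRing.
Variables (A : comNzRingType) (m : set A).
Hypotheses (noethA : noetherian A) (locm : local_ring m).
Implicit Types M N : lmodType A.

Lemma local_ideal : is_ideal m. Proof. by case: locm => [[[]]]. Qed.
Lemma local_proper : ~ m 1. Proof. by case: locm => [[[]]]. Qed.
Lemma localD a b : m a -> m b -> m (a + b). Proof. by case: local_ideal => _ + _; apply. Qed.
Lemma localM a b : m b -> m (a * b). Proof. by case: local_ideal => _ _; apply. Qed.
Lemma local0 : m 0. Proof. by case: local_ideal. Qed.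
Hint Resolve local_ideal local0 : core.

(** A proper ideal lies in a maximal one, and [m] is the only one. *)
Lemma proper_le_max (J : set A) : Defs.proper_ideal J -> J `<=` m.
Proof.
move=> Jp; have [|U [Us [UJ U1] Umax]] := noeth_max (M := A^o)
  (Q := fun U => J `<=` U /\ ~ U 1) (@noeth_mod_ring _ noethA).
  by exists J; case: Jp => /is_ideal_submod Js J1; split=> //; split.
suff <- : U = m by [].
apply: (proj2 locm); split; first by split=> //; apply/is_ideal_submod.
move=> V [/is_ideal_submod Vs V1] UV; apply/seteqP; split=> //.
by apply: Umax => //; split=> // x /UJ/UV.
Qed.

Lemma local_unit a : ~ m a -> exists b, b * a = 1.
Proof.
move=> ma; apply: contrapT => a_nonunit; apply: ma.
apply: (@proper_le_max [set c | exists b, b * a = c]); last by exists 1; rewrite mul1r.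
split=> //; split=> [|_ _ [b <-] [c <-]|c _ [b <-]].
- by exists 0; rewrite mul0r.
- by exists (b + c); rewrite mulrDl.
- by exists (c * b); rewrite mulrA.
Qed.

Lemma local_1B a : m a -> ~ m (1 - a).
Proof. by move=> ma m1a; apply: local_proper; rewrite -(subrK a 1); apply: localD. Qed.

(** Nakayama's lemma relative to a submodule [L], so that it applies to Ext without
    forming the quotient. The last generator is congruent to a combination of the
    others plus an element of [m] times itself, so it is redundant. *)
Lemma nakayama_mod (H : lmodType A) (L : set H) n (x : 'I_n -> H) :
  submod L -> (forall h, exists a : 'I_n -> A, L (h - \sum_j a j *: x j)) ->
  (forall h, exists2 z, max_ideal_mul m z & L (h - z)) -> forall h, L h.
Proof.
move=> Ls xg Lm; elim: n x xg => [|n IH] x xg.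
  by move=> h; have [a] := xg h; rewrite big_ord0 subr0.
apply: (IH (fun j => x (widen_ord (leqnSn n) j))) => h.
have mgen z : max_ideal_mul m z ->
    exists2 a : 'I_n.+1 -> A, (forall j, m (a j)) & L (z - \sum_j a j *: x j).
  move=> [k [c [w [mc ->]]]].
  have /choice[a aE] i := xg (w i).
  exists (fun j => \sum_i c i * a i j).
    move=> j; apply: (submod_sum (M := A^o)) => [|i _]; first by apply/is_ideal_submod; apply: local_ideal.
    by rewrite mulrC; apply: localM.
  have -> : \sum_j (\sum_i c i * a i j) *: x j = \sum_i c i *: \sum_j a i j *: x j.
    transitivity (\sum_j \sum_i (c i * a i j) *: x j).
      by apply: eq_bigr => j _; rewrite scaler_suml.
    rewrite exchange_big; apply: eq_bigr => i _; rewrite scaler_sumr.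
    by apply: eq_bigr => j _; rewrite scalerA.
  rewrite -sumrB; apply: submod_sum => // i _.
  by rewrite -scalerBr; apply: submodZ.
have [z mz Lz] := Lm (x ord_max); have [c mc Lc] := mgen _ mz.
have [b bE] := local_unit (local_1B (mc ord_max)).
have [a aE] := xg h.
pose l j := widen_ord (leqnSn n) j.
exists (fun j => a (l j) + a ord_max * b * c (l j)).
have := submodD Ls aE (submodZ Ls (a ord_max * b) (submodD Ls Lz Lc)).
rewrite subrKA !big_ord_recr /= -/l.
set s1 := \sum_(i < n) a _ *: _; set s2 := \sum_(i < n) c _ *: _.
have -> : \sum_(j < n) (a (l j) + a ord_max * b * c (l j)) *: x (l j) =
    s1 + (a ord_max * b) *: s2.
  rewrite scaler_sumr -big_split; apply: eq_bigr => j _.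
  by rewrite /= scalerDl scalerA.
have -> : x ord_max - (s2 + c ord_max *: x ord_max) = (1 - c ord_max) *: x ord_max - s2.
  by rewrite scalerBl scale1r opprD addrAC addrA.
by rewrite scalerBr scalerA -mulrA bE mulr1 opprD !addrA subrK -addrA -opprD.
Qed.

Lemma nakayama M : finitely_generated M -> (forall x : M, max_ideal_mul m x) -> forall x : M, x = 0.
Proof.
move=> [n [x xg]] mM; apply: (@nakayama_mod _ [set y | y = 0] n x).
- by split=> /= [|_ _ -> ->|a _ ->]; rewrite ?addr0 ?scaler0.
- by move=> h; have [a ->] := xg h; exists a; rewrite /= subrr.
- by move=> h; exists h; rewrite //= subrr.
Qed.

(** An endomorphism that is the identity modulo [m] is onto by Nakayama, hence
    bijective. This is what allows maps through free modules to be neglected. *)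
Lemma id_mod_max_bij M (f : LinHom M M) :
  finitely_generated M -> (forall x, max_ideal_mul m (x - f x)) -> bijective f.
Proof.
move=> Mfg fm; apply: surj_endo_bij => //; have [n [x xg]] := Mfg.
apply: (@nakayama_mod _ [set y | exists z, f z = y] n x); first exact: submod_im.
  by move=> h; have [a ->] := xg h; exists a; rewrite subrr; exists 0; rewrite linear0.
by move=> h; exists (h - f h) => //; exists h; rewrite opprB addrC subrK.
Qed.

End LocalRing.

(** * Prime ideals, regular elements and dimension *)

Section Primes.
Variable A : comNzRingType.
Hypothesis noethA : noetherian A.
Implicit Types (M N : lmodType A) (I P Q S : set A).

Local Notation prime := Defs.prime_ideal.

Lemma prime_ideal_submod P : prime P -> submod (P : set (A^o : lmodType A)).
Proof. by case=> [[/is_ideal_submod]]. Qed.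

Lemma primeM P a b : prime P -> P b -> P (a * b).
Proof. by case=> [[[_ _]]] + _ _; apply. Qed.

Lemma prime1 P : prime P -> ~ P 1. Proof. by case=> [[]]. Qed.

Definition submod_adjoin M (U : set M) z : set M := [set y | exists a, U (y - a *: z)].

Lemma submod_adjoinP M (U : set M) z : submod U ->
  [/\ submod (submod_adjoin U z), U `<=` submod_adjoin U z & submod_adjoin U z z].
Proof.
move=> Us; split; last by exists 1; rewrite scale1r subrr; apply: submod0.
  split=> [|x y [a xU] [b yU]|a x [b xU]].
  - by exists 0; rewrite scale0r subr0; apply: submod0.
  - by exists (a + b); rewrite scalerDl opprD addrACA; apply: submodD.
  - by exists (a * b); rewrite -scalerA -scalerBr; apply: submodZ.
by move=> y Uy; exists 0; rewrite scale0r subr0.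
Qed.

(** An ideal maximal among those containing [I] and disjoint from [S] is prime. *)
Lemma prime_disjoint I S : is_ideal I -> S 1 ->
  (forall a b, S a -> S b -> S (a * b)) -> (forall a, I a -> ~ S a) ->
  exists P, [/\ prime P, I `<=` P & forall a, P a -> ~ S a].
Proof.
move=> Ii S1 SM IS.
have [|P [Ps [IP PS] Pmax]] := noeth_max (M := A^o)
    (Q := fun U => I `<=` U /\ forall a, U a -> ~ S a) (@noeth_mod_ring _ noethA).
  by exists I; split; [apply/is_ideal_submod | split].
exists P; split=> //; split; first by split; [apply/is_ideal_submod | move=> /PS].
move=> a b Pab; apply: contrapT => /not_orP[Pa Pb].
have meetS c : ~ P c -> exists s d, S s /\ P (s - d * c).
  move=> Pc; apply: contrapT => noS; apply: Pc.
  have [Vs PV Vc] := submod_adjoinP (c : A^o) Ps.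
  apply: (Pmax _ Vs _ PV c Vc); split=> [x /IP/PV //|s [d sd] Ss].
  by apply: noS; exists s, d.
have [s [c [Ss sP]]] := meetS _ Pa; have [t [d [St tP]]] := meetS _ Pb.
apply: (PS _ _ (SM _ _ Ss St)); rewrite -(subrK (c * a) s) mulrDl.
have PM x y : P y -> P (x * y) by apply: (submodZ Ps).
apply: (submodD Ps); first by rewrite mulrC; apply: PM.
rewrite -(subrK (d * b) t) mulrDr; apply: (submodD Ps); first exact: PM.
by rewrite mulrACA; apply: PM.
Qed.

Definition ann_mod M (U : set M) z : set A := [set a | U (a *: z)].

Lemma ann_mod_ideal M (U : set M) z : submod U -> is_ideal (ann_mod U z).
Proof.
rewrite /ann_mod; move=> Us; split=> /= [|a b Ua Ub|a b Ub].
- by rewrite scale0r; apply: submod0.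
- by rewrite scalerDl; apply: submodD.
- by rewrite -scalerA; apply: submodZ.
Qed.

(** An annihilator that is maximal among the annihilators of nonzero elements is
    prime. *)
Lemma associated_prime M (U : set M) z : submod U -> ~ U z ->
  exists w, prime (ann_mod U w) /\ ann_mod U z `<=` ann_mod U w.
Proof.
move=> Us Uz.
have [|_ [_ [w [-> Uw zw]] wmax]] := noeth_max (M := A^o)
    (Q := fun V => exists w, [/\ V = ann_mod U w, ~ U w & ann_mod U z `<=` ann_mod U w])
    (@noeth_mod_ring _ noethA).
  by exists (ann_mod U z); split; [apply/is_ideal_submod/ann_mod_ideal | exists z; split].
exists w; split=> //; split.
  by split; [exact: ann_mod_ideal | rewrite /ann_mod /= scale1r].
move=> a b Uab; apply: contrapT => /not_orP[Ua Ub].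
have sub : ann_mod U w `<=` ann_mod U (b *: w).
  by move=> c Uc; rewrite /ann_mod /= scalerA mulrC -scalerA; apply: submodZ.
apply: Ua; apply: (wmax (ann_mod U (b *: w))) => //.
- by apply/is_ideal_submod/ann_mod_ideal.
- by exists (b *: w); split=> // c /zw/sub.
- by rewrite /ann_mod /= scalerA.
Qed.

(** Noetherian induction on the submodule [U]: adjoin to [U] an element whose
    annihilator modulo [U] is a prime [P]. Any other associated prime of the quotient
    by [U] is one of the quotient by the larger submodule. *)
Lemma associated_primes_finite M (U0 : set M) : finitely_generated M -> submod U0 ->
  exists L : seq (set A), forall w, prime (ann_mod U0 w) -> ann_mod U0 w \in L.
Proof.
move=> Mfg U0s; apply: contrapT => U0L.
have [|U [Us UL Umax]] := noeth_max (Q := fun U : set M =>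
    ~ exists L : seq (set A), forall w, prime (ann_mod U w) -> ann_mod U w \in L)
    (fg_noeth noethA Mfg).
  by exists U0.
have [[z Uz]|UT] := pselect (exists z, ~ U z); last first.
  apply: UL; exists [::] => w /prime1 []; apply: contrapT => Uw.
  by apply: UT; exists (1 *: w).
have [{Uz}z [zp _]] := associated_prime Us Uz.
have [Vs UV Vz] := submod_adjoinP z Us.
have Uz : ~ U z by move=> Uz; apply: (prime1 zp); rewrite /ann_mod /= scale1r.
have [L LP] : exists L : seq (set A), forall w,
    prime (ann_mod (submod_adjoin U z) w) -> ann_mod (submod_adjoin U z) w \in L.
  by apply: contrapT => VL; apply/Uz/(Umax _ Vs VL UV).
apply: UL; exists (ann_mod U z :: L) => w wp; rewrite inE.
have [[c [[b cb] Uc]]|no_c] := pselect (exists c, submod_adjoin U z (c *: w) /\ ~ U (c *: w)).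
  suff -> : ann_mod U w = ann_mod U z by rewrite eqxx.
  have Pb : ~ U (b *: z).
    by move=> Ub; apply: Uc; rewrite -(subrK (b *: z) (c *: w)); apply: submodD.
  have cbE a : U (a *: (c *: w)) <-> U (a *: (b *: z)).
    split=> Ua.
      rewrite -[_ *: (b *: z)](subKr (a *: (c *: w))) -scalerBr.
      by apply: submodB => //; apply: submodZ.
    rewrite -(subrK (b *: z) (c *: w)) scalerDr.
    by apply: submodD => //; apply: submodZ.
  apply/seteqP; split=> a Ua.
    have [_ /(_ a b)[|//|//]] := zp.
    rewrite /ann_mod /= -scalerA; apply/cbE.
    by rewrite scalerA mulrC -scalerA; apply: submodZ.
  have [_ /(_ a c)[|//|//]] := wp.
  rewrite /ann_mod /= -scalerA; apply/cbE.
  by rewrite scalerA mulrC -scalerA; apply: submodZ.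
have wE : ann_mod U w = ann_mod (submod_adjoin U z) w.
  apply/seteqP; split=> a; first by move/UV.
  by move=> Va; apply: contrapT => Ua; apply: no_c; exists a.
by rewrite wE LP ?orbT // -wE.
Qed.

(** If [x] avoids all the primes but [P], add to it an element of [I] lying in all
    the other primes and not in [P]; this exists unless another prime is contained
    in [P], and then that one is avoided together with [P]. *)
Lemma prime_avoidance I (L : seq (set A)) : is_ideal I ->
  (forall P, P \in L -> prime P /\ ~ I `<=` P) ->
  exists x, I x /\ forall P, P \in L -> ~ P x.
Proof.
move=> Ii; have [I0 ID IM] := Ii; have [n] := ubnP (size L).
elim: n L => // n IHn [|P L] /= sL LP; first by exists 0.
have [[Q [QL QP]]|LnP] := pselect (exists Q, Q \in L /\ Q `<=` P).
  (* avoiding P entails avoiding Q *)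
  have [||x [Ix xL]] := IHn (P :: rem Q L).
  - by move: sL; rewrite /= size_rem // ltnS; case: (L) QL.
  - move=> R; rewrite inE => /orP[/eqP ->|/mem_rem RL]; apply: LP.
      by rewrite mem_head.
    by rewrite inE RL orbT.
  exists x; split=> // R; rewrite inE => /orP[/eqP ->|RL].
    by apply: xL; rewrite mem_head.
  have [-> /QP|RQ] := eqVneq R Q; first by apply: xL; rewrite mem_head.
  apply: xL; move: RL; rewrite (perm_mem (perm_to_rem QL)) inE (negPf RQ) /= => RL.
  by rewrite inE RL orbT.
have [|R RL|x [Ix xL]] := IHn L; rewrite ?ltnS //.
  by apply: LP; rewrite inE RL orbT.
have [Px|Px] := pselect (P x); last first.
  by exists x; split=> // R; rewrite inE => /orP[/eqP ->|/xL].
have [Pp IP] := LP P (mem_head _ _).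
have [z [Iz Pz zL]] : exists z, [/\ I z, ~ P z & forall Q, Q \in L -> Q z].
  elim: (L) (LnP) (fun R RL => LP R (mem_behead (s := P :: L) RL)) => [|Q L' IHL] L'P L'p.
    apply: contrapT => noz; apply: IP => z Iz; apply: contrapT => Pz.
    by apply: noz; exists z.
  have [[R [RL RP]]|R RL|z [Iz Pz zL]] := IHL.
  - by apply: L'P; exists R; rewrite inE RL orbT.
  - by apply: L'p; rewrite inE RL orbT.
  have [q [Qq Pq]] : exists q, Q q /\ ~ P q.
    apply: contrapT => noq; apply: L'P; exists Q; rewrite mem_head; split=> // q Qq.
    by apply: contrapT => Pq; apply: noq; exists q.
  exists (q * z); split; first exact: IM.
    by move=> Pqz; case: (proj2 Pp _ _ Pqz).
  move=> R; rewrite inE => /orP[/eqP ->|RL].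
    by rewrite mulrC; apply: primeM Qq; case: (L'p Q (mem_head _ _)).
  by apply: primeM (zL R RL); case: (L'p R); rewrite ?inE ?RL ?orbT.
exists (x + z); split=> [|R]; first exact: ID.
rewrite inE => /orP[/eqP ->|RL].
  move=> Pxz; apply: Pz; rewrite -(addKr x z).
  by apply: (submodD (prime_ideal_submod Pp)) => //; apply: (submodN (prime_ideal_submod Pp)).
move=> Rxz; apply: (xL R RL); rewrite -(addrK z x).
have [Rp _] : prime R /\ ~ I `<=` R by apply: LP; rewrite inE RL orbT.
by apply: (submodB (prime_ideal_submod Rp)) => //; apply: zL.
Qed.

(** The zero divisors on [N] form the union of finitely many primes, each of which is
    the annihilator of a nonzero element and so does not contain [I]. *)
Lemma regular_element I N : is_ideal I -> finitely_generated N ->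
  (forall z : N, z <> 0 -> exists2 a, I a & a *: z <> 0) ->
  exists2 x, I x & forall y : N, x *: y = 0 -> y = 0.
Proof.
move=> Ii Nfg I_nonzero.
have zs : submod [set z : N | z = 0].
  by split=> /= [|_ _ -> ->|a _ ->]; rewrite ?addr0 ?scaler0.
have [L LP] := associated_primes_finite Nfg zs.
pose ass P := exists w, P = ann_mod [set z : N | z = 0] w /\ prime P.
have [||x [Ix xL]] := @prime_avoidance I [seq P <- L | `[<ass P>]] => //.
  move=> P; rewrite mem_filter => /andP[/asboolP[w [-> wp]] _]; split=> // Iw.
  have [|a /Iw] := I_nonzero w; last by [].
  by move=> w0; apply: (prime1 wp); rewrite /ann_mod /= w0 scaler0.
exists x => // y xy0; apply: contrapT => y0.
have [w [wp yw]] := associated_prime zs y0.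
apply: (xL (ann_mod [set z | z = 0] w)); last exact: yw.
by rewrite mem_filter LP // andbT; apply/asboolP; exists w.
Qed.

End Primes.

(** ** Regular sequences *)

Section RegularSequences.
Variable A : comNzRingType.
Implicit Types (M N : lmodType A) (x : nat -> A).

(** The submodule [(x 0, ..., x n.-1) M], by recursion so that passing from the
    quotient by [n] elements to the quotient by [n.+1] is dividing by [x n]. *)
Fixpoint seq_span M x n : set M :=
  if n is n'.+1 then [set y | exists z, seq_span x n' (y - x n' *: z)]
  else [set y | y = 0].

(** The quotient of [M] by the sequence may vanish: the zero module is to be
    included, since it occurs as a syzygy. *)
Definition weakly_regular M x n : Prop :=
  forall i, (i < n)%N -> forall y : M, seq_span x i (x i *: y) -> seq_span x i y.

Lemma submod_seq_span M x n : submod (@seq_span M x n).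
Proof.
elim: n => [|n IH] /=; first by split=> /= [|_ _ -> ->|a _ ->]; rewrite ?addr0 ?scaler0.
split=> /= [|y z [u yu] [v zv]|a y [u yu]].
- by exists 0; rewrite scaler0 subr0; apply: submod0.
- by exists (u + v); rewrite scalerDr opprD addrACA; apply: submodD.
- exists (a *: u); rewrite scalerA [x n * a]mulrC -scalerA -scalerBr.
  exact: submodZ.
Qed.
Hint Resolve submod_seq_span : core.

Lemma seq_span_le M x n : @seq_span M x n `<=` seq_span x n.+1.
Proof. by move=> y yn; exists 0; rewrite scaler0 subr0. Qed.

Lemma seq_span_mul M x n (y : M) : seq_span x n.+1 (x n *: y).
Proof. by exists y; rewrite subrr; apply: submod0. Qed.

Lemma seq_span_lin M N (f : LinHom M N) x n y : seq_span x n y -> seq_span x n (f y).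
Proof.
elim: n y => [|n IH] y /=; first by move->; rewrite linear0.
by move=> [z /IH]; rewrite linearB linearZ => yz; exists (f z).
Qed.

Lemma weakly_regular_iso M N x n :
  isomorphic M N -> weakly_regular M x n -> weakly_regular N x n.
Proof.
move=> [f /bij_inverse[g [fK gK]]] xM i lin y /(seq_span_lin g).
by rewrite linearZ => /(xM i lin)/(seq_span_lin f); rewrite gK.
Qed.

Lemma weakly_regular_le M x n k :
  (k <= n)%N -> weakly_regular M x n -> weakly_regular M x k.
Proof. by move=> kn xM i ik; apply: xM; apply: leq_trans kn. Qed.

Lemma seq_span_ext M x x' n : (forall i, (i < n)%N -> x i = x' i) ->
  @seq_span M x n = seq_span x' n.
Proof.
elim: n => //= n IH xx'; rewrite IH ?xx' // => i /ltnW; exact: xx'.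
Qed.

Lemma in_ideal_mulE M n (x : nat -> A) i (y : M) : (i <= n)%N ->
  in_ideal_mul (fun j : 'I_n => x j) i y <-> seq_span x i y.
Proof.
elim: i y => [|i IH] y lin /=.
  split=> [[z ->]|->]; first by rewrite big_pred0.
  by exists (fun=> 0); rewrite big_pred0.
have i_split (z : 'I_n -> M) :
    \sum_(j < n | (j < i.+1)%N) x j *: z j =
    x i *: z (Ordinal lin) + \sum_(j < n | (j < i)%N) x j *: z j.
  rewrite (bigD1 (Ordinal lin)) //=; congr (_ + _); apply: eq_bigl => j.
  by rewrite ltnS -val_eqE /= [RHS]ltn_neqAle andbC.
split=> [[z ->]|[u /IH[|z zE]]]; last 2 first.
- exact: ltnW.
- exists (fun j : 'I_n => if (j < i)%N then z j else u).
  rewrite i_split /= ltnn -[LHS](subrK (x i *: u)) zE addrC; congr (_ + _).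
  by apply: eq_bigr => j ->.
exists (z (Ordinal lin)); rewrite i_split addrAC subrr add0r.
by apply/IH; [apply: ltnW | exists z].
Qed.

(** A prime containing the annihilator of the quotient by [i.+1] elements is not
    minimal over the annihilator of the quotient by [i] elements, because [x i] is
    regular there. Descending from [m] gives a chain of primes of length [n]. *)
Lemma regular_sequence_dim M x n d (m : set A) :
  noetherian A -> local_ring m -> krull_dim A d ->
  weakly_regular M x n -> ~ (forall y : M, seq_span x n y) -> (n <= d)%N.
Proof.
move=> noethA locm [_ dim] xM Mn.
pose ann i : set A := [set a | forall y : M, seq_span x i (a *: y)].
have ann_ideal i : is_ideal (ann i).
  split=> [y|a b Ia Ib y|a b Ib y]; first by rewrite scale0r; apply: submod0.
    by rewrite scalerDl; apply: submodD.
  by rewrite -scalerA; apply: submodZ.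
have chain i (P : set A) : (i <= n)%N -> Defs.prime_ideal P -> ann i `<=` P ->
    exists Q : nat -> set A, [/\ forall j, Defs.prime_ideal (Q j),
      forall j, (j < i)%N -> Q j `<` Q j.+1 & Q i = P].
  elim: i P => [|i IH] P lin Pp annP; first by exists (fun=> P).
  (* a prime disjoint from S lies in P and misses x i *)
  pose S := [set a | exists s k, ~ P s /\ a = s * x i ^+ k].
  have [||||Q [Qp annQ QS]] := @prime_disjoint _ noethA (ann i) S.
  - exact: ann_ideal.
  - by exists 1, 0%N; rewrite mulr1; split=> //; apply: prime1.
  - move=> _ _ [s [k [Ps ->]]] [t [l [Pt ->]]]; exists (s * t), (k + l)%N.
    by rewrite mulrACA exprD; split=> // /(proj2 Pp)[].
  - move=> a ia [s [k [Ps E]]]; rewrite {}E in ia; apply: Ps; apply: annP => y.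
    apply: seq_span_le; elim: k ia => [|k IHk] ia; first by have:= ia y; rewrite mulr1.
    apply: IHk => z; apply: (xM i lin); rewrite scalerA.
    by rewrite mulrCA -exprS.
  have PQ : Q `<` P.
    split; last first.
      move=> /(_ (x i)) PQ; apply: (QS (x i)); last first.
        by exists 1, 1%N; rewrite mul1r; split=> //; apply: prime1.
      by apply: PQ; apply: annP => y; apply: seq_span_mul.
    move=> a Qa; apply: contrapT => Pa; apply: (QS a Qa).
    by exists a, 0%N; rewrite mulr1.
  have [R [Rp RR Ri]] := IH Q (ltnW lin) Qp annQ.
  exists (fun j => if j == i.+1 then P else R j); rewrite eqxx; split=> //.
    by move=> j; case: ifP.
  move=> j; rewrite ltnS leq_eqVlt => /orP[/eqP ->|ji].
    by rewrite eqxx ltn_eqF // Ri.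
  by rewrite eqSS (ltn_eqF ji) (ltn_eqF (ltnW ji : (j < i.+1)%N)); apply: RR.
have m_prime : Defs.prime_ideal m.
  split; first by case: locm => [[]].
  move=> a b mab; apply: contrapT => /not_orP[/(local_unit noethA locm)[a' a'a] mb].
  by apply: mb; rewrite -[b]mul1r -a'a -mulrA; apply: localM.
have [//|//||Q [Qp QQ _]] := chain n m.
  apply: (proper_le_max noethA locm); split=> // ann1; apply: Mn => y.
  by have := ann1 y; rewrite scale1r.
apply: (dim n (fun j => Q j)); split=> // i j ij.
have lejn : (j <= n)%N by rewrite -ltnS.
elim: {j}(val j) ij lejn => //= j IH; rewrite ltnS leq_eqVlt => /orP[/eqP ->|ij] jn.
  exact: QQ.
have [Qij Qji] := IH ij (ltnW jn); have [Qj Qj'] := QQ j jn.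
by split=> [y /Qij/Qj //|Q']; apply: Qji => y /Qj/Q'.
Qed.

End RegularSequences.

(** * Vanishing of Ext through an injective coresolution *)

Section ShortExact.
Variable A : comNzRingType.
Implicit Types M N : lmodType A.

Definition short_exact M' M M'' (i : LinHom M' M) (p : LinHom M M'') : Prop :=
  [/\ injective i, surj p & forall x, p x = 0 <-> exists y, x = i y].

Lemma short_exact0 M' M M'' (i : LinHom M' M) (p : LinHom M M'') y :
  short_exact i p -> p (i y) = 0.
Proof. by case=> _ _ ip; apply/ip; exists y. Qed.

Lemma LinHom_sumE M N (I : Type) (r : seq I) (F : I -> LinHom M N) x :
  (\sum_(j <- r) F j) x = \sum_(j <- r) F j x.
Proof. by apply: (big_morph (fun f : LinHom M N => f x)). Qed.

Lemma submod_exact M (U : set M) : noetherian A -> finitely_generated M -> submod U ->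
  exists (M' M'' : lmodType A) (i : LinHom M' M) (p : LinHom M M''),
    [/\ short_exact i p, finitely_generated M', finitely_generated M'' &
        forall x, U x <-> p x = 0].
Proof.
move=> noethA Mfg Us; have [M'' [p [ps pU]]] := quotient_exists Us.
have [M' [i [ii M'fg iU]]] := submodule_exists noethA Mfg Us.
exists M', M'', i, p; split=> //; last by move=> x; split=> /pU.
  by split=> // x; split=> [/pU/iU //|[y ->]]; apply/pU/iU; exists y.
exact: fg_surj ps Mfg.
Qed.

Lemma fg_cover M : noetherian A -> finitely_generated M ->
  exists n (K : lmodType A) (i : LinHom K 'rV[A]_n) (p : LinHom 'rV[A]_n M),
    short_exact i p /\ finitely_generated K.
Proof.
move=> noethA /finitely_generatedP[n [p ps]].
have [K [i [ii Kfg iE]]] := submodule_exists noethA (fg_row A n) (submod_ker p).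
by exists n, K, i, p.
Qed.

(** An injective coresolution [N -> E 0 -> E 1 -> ...] is cut into the short exact
    sequences [0 -> C j -> E j -> C j.+1 -> 0] with [C 0] isomorphic to [N]. *)
Record coresolution N := Coresolution {
  cosyz : nat -> lmodType A;
  cores : nat -> lmodType A;
  cosyz_in : forall j, LinHom (cosyz j) (cores j);
  cosyz_out : forall j, LinHom (cores j) (cosyz j.+1);
  cores_injective : forall j, injective_module (cores j);
  cores_exact : forall j, short_exact (cosyz_in j) (cosyz_out j);
  cosyz0 : isomorphic N (cosyz 0) }.

End ShortExact.

Section Ext.
Variables (A : comNzRingType) (T : lmodType A) (R : coresolution T).
Implicit Types M N : lmodType A.
Local Notation C := (cosyz R).
Local Notation E := (cores R).
Local Notation iota := (cosyz_in R).
Local Notation pi := (cosyz_out R).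

(** [Ext^j(M,T)] is the quotient of [Hom(M, C j)] by the maps that lift to
    [E j.-1]; in degree [0] only the zero map is trivial. *)
Definition ext_trivial M j : LinHom M (C j) -> Prop :=
  match j with
  | 0 => fun f => forall x, f x = 0
  | j'.+1 => fun f => exists g : LinHom M (E j'), forall x, f x = pi j' (g x)
  end.

Definition ext_zero j M : Prop := forall f : LinHom M (C j), ext_trivial f.

Let iota_inj j : injective (iota j). Proof. by case: (cores_exact R j). Qed.
Let pi_surj j : surj (pi j). Proof. by case: (cores_exact R j). Qed.
Let piP j x : pi j x = 0 <-> exists y, x = iota j y. Proof. by case: (cores_exact R j). Qed.
Let pi_iota j y : pi j (iota j y) = 0. Proof. exact: short_exact0 (cores_exact R j). Qed.

Lemma submod_ext_trivial M j : submod [set f : LinHom M (C j) | ext_trivial f].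
Proof.
case: j => [|j]; split=> //=.
- by move=> f g f0 g0 x /=; rewrite f0 g0 addr0.
- by move=> a f f0 x /=; rewrite f0 scaler0.
- by exists 0 => x; rewrite linear0.
- by move=> f g [f' fE] [g' gE]; exists (f' + g') => x /=; rewrite fE gE linearD.
- by move=> a f [f' fE]; exists (a *: f') => x /=; rewrite fE linearZ.
Qed.

Lemma ext_trivialD M j (f g : LinHom M (C j)) :
  ext_trivial f -> ext_trivial g -> ext_trivial (f + g).
Proof. by case: (submod_ext_trivial M j) => _ + _; apply. Qed.

Lemma ext_trivial0 M j : ext_trivial (0 : LinHom M (C j)).
Proof. by case: (submod_ext_trivial M j). Qed.

Lemma ext_trivial_ext M j (f g : LinHom M (C j)) :
  (forall x, f x = g x) -> ext_trivial f -> ext_trivial g.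
Proof. by move=> fg; rewrite (LinHom_ext fg). Qed.

Lemma ext_trivial_comp M N j (f : LinHom N (C j)) (h : LinHom M N) :
  ext_trivial f -> ext_trivial (lin_comp f h).
Proof.
case: j f => [|j] f /=; first by move=> f0 x; rewrite f0.
by move=> [g gE]; exists (lin_comp g h) => x; rewrite gE.
Qed.

Lemma ext_trivial_extend M N j (i : LinHom M N) (f : LinHom M (C j)) :
  injective i -> ext_trivial f ->
  exists2 g : LinHom N (C j), ext_trivial g & forall x, g (i x) = f x.
Proof.
move=> ii; case: j f => [|j] f /=; first by move=> f0; exists 0.
move=> [g gE]; have [h hE] := cores_injective g ii.
by exists (lin_comp (pi j) h) => [|x /=]; [exists h | rewrite hE gE].
Qed.

Lemma ext_zero_iso j M N : isomorphic M N -> ext_zero j M -> ext_zero j N.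
Proof.
move=> [f /bij_inverse[g [fK gK]]] M0 h.
by apply: ext_trivial_ext (ext_trivial_comp g (M0 (lin_comp h f))) => x /=; rewrite gK.
Qed.

Lemma ext_zero_null j M : (forall x : M, x = 0) -> ext_zero j M.
Proof.
move=> M0 f; apply: (@ext_trivial_ext _ _ 0); last exact: ext_trivial0.
by move=> x; rewrite (M0 x) !linear0.
Qed.

Lemma ext_zero_row j n : ext_zero j.+1 'rV[A]_n.
Proof.
move=> f; have [|g gE] := lift_free (p := pi j) (g := f).
  by move=> l; apply: pi_surj.
by exists g.
Qed.

Lemma ext_zero_retract j M N (i : LinHom M N) (r : LinHom N M) :
  (forall x, r (i x) = x) -> ext_zero j N -> ext_zero j M.
Proof.
move=> ri N0 f; apply: ext_trivial_ext (ext_trivial_comp i (N0 (lin_comp f r))).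
by move=> x /=; rewrite ri.
Qed.

(** ** Pieces of the long exact sequence *)

Section Sequence.
Variables (M' M M'' : lmodType A) (i : LinHom M' M) (p : LinHom M M'').
Hypothesis ip : short_exact i p.
Let ii : injective i. Proof. by case: ip. Qed.
Let ps : surj p. Proof. by case: ip. Qed.

Let factor_p N (f : LinHom M N) : (forall y, f (i y) = 0) ->
  exists g : LinHom M'' N, forall x, g (p x) = f x.
Proof.
by move=> fi; apply: factor_surj => // x; case: ip => _ _ -> [y ->].
Qed.

(** A map that is trivial on [M'] becomes zero there after subtracting a trivial map
    on [M], by injectivity of the modules [E j]; then it factors through [M'']. *)
Lemma ext_zero_ext j : ext_zero j M' -> ext_zero j M'' -> ext_zero j M.
Proof.
move=> M'0 M''0 f; have [g g0 gE] := ext_trivial_extend ii (M'0 (lin_comp f i)).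
have [|h hE] := factor_p (f := f - g); first by move=> y /=; rewrite gE subrr.
apply: (@ext_trivial_ext _ _ (lin_comp h p + g)); first by move=> x /=; rewrite hE /= subrK.
exact: ext_trivialD (ext_trivial_comp _ (M''0 h)) g0.
Qed.

(** The obstruction to extending [f] is its image under the connecting map. *)
Lemma ext_zero_extend j (f : LinHom M' (C j)) : ext_zero j.+1 M'' ->
  exists g : LinHom M (C j), forall y, g (i y) = f y.
Proof.
move=> M''0; have [h hE] := cores_injective (lin_comp (iota j) f) ii.
have [|k kE] := factor_p (f := lin_comp (pi j) h).
  by move=> y /=; rewrite hE /= pi_iota.
have [l lE] := M''0 k.
have [|g gE] := factor_inj (g := h - lin_comp l p) (@iota_inj j).
  by move=> x; apply/piP; rewrite linearB /= -lE kE subrr.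
exists g => y; apply: (@iota_inj j).
by rewrite gE /= hE /= (short_exact0 _ ip) linear0 subr0.
Qed.

Lemma ext_zero_sub j : ext_zero j M -> ext_zero j.+1 M'' -> ext_zero j M'.
Proof.
move=> M0 M''0 f; have [g gE] := ext_zero_extend f M''0.
exact: (ext_trivial_ext (f := lin_comp g i)) gE (ext_trivial_comp i (M0 g)).
Qed.

Lemma ext_zero_quo j : ext_zero j M' -> ext_zero j.+1 M -> ext_zero j.+1 M''.
Proof.
move=> M'0 M0 f; have [g gE] := M0 (lin_comp f p).
have [|h hE] := factor_inj (g := lin_comp g i) (@iota_inj j).
  by move=> y; apply/piP; rewrite /= -gE /= (short_exact0 _ ip) linear0.
have [k _ kE] := ext_trivial_extend ii (M'0 h).
have [|l lE] := factor_p (f := g - lin_comp (iota j) k).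
  by move=> y /=; rewrite kE hE /= subrr.
exists l => x; have [z <-] := ps x.
by rewrite lE linearB /= pi_iota subr0 -gE.
Qed.

(** The connecting map from [Ext^j(M',T)] to [Ext^j.+1(M'',T)] is onto, so that
    generators of the former give generators of the latter. *)
Lemma ext_generated j n (f : 'I_n -> LinHom M' (C j)) : ext_zero j.+1 M ->
  (forall g : LinHom M' (C j), exists a : 'I_n -> A,
     ext_trivial (g - \sum_l a l *: f l)) ->
  exists f' : 'I_n -> LinHom M'' (C j.+1), forall g : LinHom M'' (C j.+1),
    exists a : 'I_n -> A, ext_trivial (g - \sum_l a l *: f' l).
Proof.
move=> M0 fg.
have /choice[F FE] l : exists F : LinHom M (E j), forall y, F (i y) = iota j (f l y).
  exact: cores_injective (lin_comp (iota j) (f l)) ii.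
have /choice[f' f'E] l : exists g : LinHom M'' (C j.+1), forall x, g (p x) = pi j (F l x).
  by apply: (factor_p (f := lin_comp (pi j) (F l))) => y /=; rewrite FE pi_iota.
exists f' => g; have [G GE] := M0 (lin_comp g p).
have [|h hE] := factor_inj (g := lin_comp G i) (@iota_inj j).
  by move=> y; apply/piP; rewrite /= -GE /= (short_exact0 _ ip) linear0.
have [a a0] := fg h; exists a.
have [k _ kE] := ext_trivial_extend ii a0.
have [|l lE] := factor_p (f := G - \sum_l a l *: F l - lin_comp (iota j) k).
  move=> y /=; rewrite kE /= !LinHom_sumE linearB hE /= [X in _ - (_ - X)]linear_sum.
  rewrite (eq_bigr (fun l => iota j ((a l *: f l) y))) ?subrr // => l _.
  by rewrite /= FE linearZ.
exists l => x; have [z <-] := ps x.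
rewrite lE !linearB /= pi_iota subr0 -GE /= !LinHom_sumE [pi _ (\sum_(_ < _) _)]linear_sum.
by congr (_ - _); apply: eq_bigr => r _; rewrite /= linearZ f'E.
Qed.

End Sequence.

Hypothesis noethA : noetherian A.
Hypothesis Hom_fg : forall M, finitely_generated M -> finitely_generated (LinHom M T : lmodType A).

(** Ext is finitely generated, by dimension shifting along free covers. *)
Lemma ext_fg j M : finitely_generated M ->
  exists n (f : 'I_n -> LinHom M (C j)), forall g, exists a : 'I_n -> A,
    ext_trivial (g - \sum_l a l *: f l).
Proof.
move=> Mfg; elim: j M Mfg => [|j IH] M Mfg; last first.
  have [b [K [i [p [ip Kfg]]]]] := fg_cover noethA Mfg.
  have [n [f fg]] := IH K Kfg; exists n.
  exact: (ext_generated ip (@ext_zero_row j b) fg).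
have [e /bij_inverse[e' [_ e'K]]] := cosyz0 R.
have [n [f fg]] := Hom_fg Mfg; exists n, (fun l => lin_comp e (f l)) => g.
have [a aE] := fg (lin_comp e' g); exists a => x /=.
rewrite -[g x]e'K -[e' _]/(lin_comp e' g x) aE !LinHom_sumE linear_sum.
by apply/eqP; rewrite subr_eq0; apply/eqP/eq_bigr => l _; rewrite /= linearZ.
Qed.

Variable m : set A.
Hypothesis locm : local_ring m.

(** Multiplication by [x] is onto on [Ext^j(N,T)] if [Ext^j.+1(N/xN,T) = 0], so
    that Nakayama applies. *)
Lemma ext_zero_regular j N N' x (p : LinHom N N') : finitely_generated N -> m x ->
  (forall y : N, x *: y = 0 -> y = 0) -> surj p ->
  (forall y, p y = 0 <-> exists z, y = x *: z) ->
  ext_zero j.+1 N' -> ext_zero j N.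
Proof.
move=> Nfg mx x_reg ps pP N'0.
have x_lin : linear (fun y : N => x *: y).
  by move=> a u v; rewrite scalerDr !scalerA mulrC.
have xp : short_exact (lin_of x_lin) p by split=> //; apply: ker0_inj.
have [n [f fg]] := ext_fg j Nfg.
apply: (nakayama_mod noethA locm (submod_ext_trivial N j) fg) => h.
have [g gE] := ext_zero_extend xp h N'0; exists (x *: g); first exact: max_ideal_mulZ.
apply: (@ext_trivial_ext _ _ 0); last exact: ext_trivial0.
by move=> y /=; rewrite -gE /= linearZ subrr.
Qed.

End Ext.

(** * Finite injective dimension and depth *)

Section CoresolutionExists.
Variable A : comNzRingType.
Implicit Types M N : lmodType A.

(** The states of the iteration that builds a coresolution: the bound on the
    injective dimension is carried along and decreases at each step. *)
Record bounded_module := BoundedModule {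
  bm_sort : lmodType A;
  bm_dim : nat;
  bm_dim_le : inj_dim_le bm_dim bm_sort }.

Record injective_step (t : bounded_module) := InjectiveStep {
  step_mid : lmodType A;
  step_next : lmodType A;
  step_in : LinHom (bm_sort t) step_mid;
  step_out : LinHom step_mid step_next;
  step_injective : injective_module step_mid;
  step_exact : short_exact step_in step_out;
  step_dim_le : inj_dim_le (bm_dim t).-1 step_next }.

Lemma injective_step_exists t : inhabited (injective_step t).
Proof.
case: t => N [|n] /= Nn; last first.
  have [E [C [i [p [Ei ii ps ip Cn]]]]] := Nn.
  have ex : short_exact i p by split.
  by split; apply: (@InjectiveStep (@BoundedModule N n.+1 Nn) _ _ _ _ Ei ex Cn).
have zero_inj : inj_dim_le 0 ('rV[A]_0 : lmodType A).
  by move=> U V i f _; exists 0 => u; apply/rowP => -[].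
have ex : short_exact (lin_id N) (0 : LinHom N 'rV[A]_0).
  split=> [//||x]; first by move=> y; exists 0; apply/rowP => -[].
  by split=> // _; exists x.
by split; apply: (@InjectiveStep (@BoundedModule N 0 Nn) _ _ _ _ Nn ex zero_inj).
Qed.

Definition injective_step_of t : injective_step t :=
  inhabited_witness (injective_step_exists t).

Definition bounded_next t : bounded_module :=
  BoundedModule (step_dim_le (injective_step_of t)).

Lemma injective_cosyz n N : inj_dim_le n N ->
  exists R : coresolution N, injective_module (cosyz R n).
Proof.
move=> Nn; pose t k := iter k bounded_next (BoundedModule Nn).
have t0 : isomorphic N (bm_sort (t 0)) by apply: isomorphic_refl.
exists (@Coresolution A N (fun k => bm_sort (t k))
  (fun k => step_mid (injective_step_of (t k)))
  (fun k => step_in (injective_step_of (t k)))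
  (fun k => step_out (injective_step_of (t k)))
  (fun k => @step_injective _ (injective_step_of (t k)))
  (fun k => step_exact (injective_step_of (t k))) t0) => /=.
have tk k : bm_dim (t k) = (n - k)%N.
  by elim: k => [|k IH]; rewrite ?subn0 //= IH subnS.
by have := bm_dim_le (t n); rewrite tk subnn.
Qed.

(** From an injective [C n] on, the sequences of the coresolution split. *)
Lemma injective_ext_zero N (R : coresolution N) n : injective_module (cosyz R n) ->
  forall l M, (n < l)%N -> ext_zero R l M.
Proof.
move=> Cn; suff split_n k : (n <= k)%N ->
    exists s : LinHom (cosyz R k.+1) (cores R k), forall x, cosyz_out R k (s x) = x.
  move=> [//|l] M /split_n[s sK] f; exists (lin_comp s f) => x.
  by rewrite /= sK.
have split_k l : injective_module (cosyz R l) ->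
    exists s : LinHom (cosyz R l.+1) (cores R l), forall x, cosyz_out R l (s x) = x.
  move=> Cl; have [ii ps ip] := cores_exact R l.
  have [r rE] := Cl _ _ _ (lin_id _) ii.
  have [|s sE] := factor_surj (g := lin_id _ - lin_comp (cosyz_in R l) r) ps.
    by move=> _ /ip[y ->] /=; rewrite rE /= subrr.
  exists s => x; have [y <-] := ps x; rewrite sE linearB /=.
  by rewrite (short_exact0 _ (cores_exact R l)) subr0.
suff Ck l : (n <= l)%N -> injective_module (cosyz R l) by move=> /Ck/split_k.
elim: l => [|l IH]; first by rewrite leqn0 => /eqP <-.
rewrite leq_eqVlt => /orP[/eqP <- //|/IH /split_k[s sK]] U V i f ii.
have [g gE] := cores_injective (lin_comp s f) ii.
by exists (lin_comp (cosyz_out R l) g) => u; rewrite /= gE /= sK.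
Qed.

Lemma row1_ring : isomorphic ('rV[A]_1 : lmodType A) (A^o : lmodType A).
Proof.
have f_lin : linear (fun v : 'rV[A]_1 => v 0 0 : A^o) by move=> a u v; rewrite !mxE.
exists (lin_of f_lin); exists (fun a : A => a%:M) => [v|a] /=; last by rewrite mxE eqxx.
by apply/rowP => j; rewrite ord1 mxE eqxx.
Qed.

Hypothesis noethA : noetherian A.

(** A form is determined by its values on generators. *)
Lemma dual_fg M : finitely_generated M -> finitely_generated (dual M).
Proof.
move=> [n [x xg]].
have f_lin : linear (fun g : dual M => \row_j (g (x j) : A)).
  by move=> a g h; apply/rowP => j; rewrite !mxE.
apply: (fg_inj noethA (i := lin_of f_lin)); last exact: fg_row.
apply: ker0_inj => g /rowP g0; apply: LinHom_ext => y.
have [a ->] := xg y; rewrite linear_sum big1 // => j _.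
by rewrite linearZ /=; have := g0 j; rewrite !mxE => ->; rewrite scaler0.
Qed.

End CoresolutionExists.

Section Depth.
Variables (A : comNzRingType) (m : set A) (R : coresolution (A^o : lmodType A)).
Hypotheses (noethA : noetherian A) (locm : local_ring m).
Implicit Types (M N Q K : lmodType A).

Let ext_zero_reg := ext_zero_regular (R := R) noethA (@dual_fg _ noethA) locm.

(** The modules isomorphic to the residue field [A/m]. *)
Definition residue_module K : Prop :=
  exists z : K, (forall y, exists a, y = a *: z) /\ (forall a, a *: z = 0 <-> m a).

Lemma residue_module_iso K K' : residue_module K -> residue_module K' -> isomorphic K K'.
Proof.
move=> [z [zg zm]] [z' [z'g z'm]].
have f_lin : linear (fun a : A^o => a *: z) by move=> a u v; rewrite scalerDl scalerA.
have f'_lin : linear (fun a : A^o => a *: z') by move=> a u v; rewrite scalerDl scalerA.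
have [||g gE] := factor_surj (f := lin_of f_lin) (g := lin_of f'_lin).
- by move=> y; have [a ->] := zg y; exists a.
- by move=> a /zm/z'm.
exists g; apply: bij_inj_surj.
  apply: ker0_inj => y; have [a ->] := zg y.
  by rewrite -[a *: z]/(lin_of f_lin a) gE => /z'm/zm.
by move=> y; have [a ->] := z'g y; exists (a *: z); apply: gE.
Qed.

Lemma cyclic_submod M (z : M) : submod [set y | exists a, y = a *: z].
Proof.
split=> /= [|_ _ [a ->] [b ->]|b _ [a ->]].
- by exists 0; rewrite scale0r.
- by exists (a + b); rewrite scalerDl.
- by exists (b * a); rewrite scalerA.
Qed.

(** In the top degree, the vanishing of Ext is detected by the residue field.
    Otherwise divide [M] by a submodule that is maximal among those whose quotient
    has nonzero Ext. The quotient contains some [A/P] with [P] prime, whose Ext must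
    then be nonzero; so [P] is not [m], but an element of [m] outside [P] is regular
    on [A/P], which contradicts Nakayama. *)
Lemma ext_zero_residue j :
  (forall N, finitely_generated N -> ext_zero R j.+1 N) ->
  (forall K, residue_module K -> ext_zero R j K) ->
  forall M, finitely_generated M -> ext_zero R j M.
Proof.
move=> top res M Mfg; apply: contrapT => M0.
have Us0 : submod [set x : M | x = 0].
  by split=> /= [|_ _ -> ->|a _ ->]; rewrite ?addr0 ?scaler0.
have [|U [Us [Q [p [ps pU Q0]]] Umax]] := noeth_max (Q := fun U : set M =>
    exists Q (p : LinHom M Q), [/\ surj p, forall x, p x = 0 <-> U x & ~ ext_zero R j Q])
    (fg_noeth noethA Mfg).
  exists [set x | x = 0]; split=> //; exists M, (lin_id M); split=> // y; by exists y.
have Qfg := fg_surj ps Mfg.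
have [w wp] : exists w, Defs.prime_ideal (ann_mod U w).
  have [[z Uz]|UT] := pselect (exists z, ~ U z).
    by have [w [wp _]] := associated_prime noethA Us Uz; exists w.
  case: Q0; apply: ext_zero_null => y; have [x <-] := ps y.
  by apply/pU; apply: contrapT => Ux; apply: UT; exists x.
have Uw : ~ U w by move=> Uw; apply: (prime1 wp); rewrite /ann_mod /= scale1r.
have [K [Q'' [i [q [iq Kfg Q''fg qE]]]]] :=
  submod_exact noethA Qfg (cyclic_submod (p w)).
apply: Q0; apply: (ext_zero_ext iq); last first.
  apply: contrapT => Q''0; apply: Uw.
  apply: (Umax [set x | q (p x) = 0]); first exact: (submod_ker (lin_comp q p)).
  - exists Q'', (lin_comp q p); split=> //; case: iq => _ qs _ y.
    by have [z <-] := qs y; have [x <-] := ps z; exists x.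
  - by move=> x /pU /= ->; rewrite linear0.
  - by apply/qE; exists 1; rewrite scale1r.
have [ii _ ip] := iq.
have [z zE] : exists z, p w = i z by apply/ip/qE; exists 1; rewrite scale1r.
have zg y : exists a, y = a *: z.
  have [|a aE] := (qE (i y)).2; first by apply/ip; exists y.
  by exists a; apply: ii; rewrite aE zE linearZ.
have z_ann a : a *: z = 0 <-> ann_mod U w a.
  rewrite /ann_mod /=; split=> [az0|/pU].
    by apply/pU; rewrite linearZ /= zE -linearZ /= az0 linear0.
  by rewrite linearZ /= zE -linearZ => /(inj_ker0 ii).
have Pm : ann_mod U w `<=` m by apply: (proper_le_max noethA locm); case: wp.
have [mP|/existsNP[x /not_implyP[mx Px]]] := pselect (m `<=` ann_mod U w).
  by apply: res; exists z; split=> // a; split=> [/z_ann/Pm //|/mP/z_ann].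
have [K' [k [ks kE]]] := quotient_exists (submod_im (x *: lin_id K)).
apply: (ext_zero_reg Kfg mx (p := k)) => //.
- move=> y; have [a ->] := zg y; rewrite scalerA => /z_ann xa.
  by apply/z_ann; case: (proj2 wp _ _ xa).
- by move=> y; split=> [/kE[u <-]|[u ->]]; [exists u | apply/kE; exists u].
- by apply: top; apply: fg_surj ks Kfg.
Qed.

(** ** Ext of quotients by regular sequences *)

Definition seq_quot M (x : nat -> A) i Q (p : LinHom M Q) : Prop :=
  surj p /\ forall y, p y = 0 <-> seq_span x i y.

Lemma seq_quot_exists M (x : nat -> A) i : exists Q (p : LinHom M Q), seq_quot x i p.
Proof. exact: quotient_exists (submod_seq_span M x i). Qed.

Lemma seq_quot_fg M (x : nat -> A) i Q (p : LinHom M Q) :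
  seq_quot x i p -> finitely_generated M -> finitely_generated Q.
Proof. by case=> ps _; apply: fg_surj ps. Qed.

Lemma seq_quot_step M (x : nat -> A) i Q (p : LinHom M Q) Q' (p' : LinHom M Q') :
  seq_quot x i p -> seq_quot x i.+1 p' ->
  exists f : LinHom Q Q', [/\ forall y, f (p y) = p' y, surj f &
    forall y, f y = 0 <-> exists z, y = x i *: z].
Proof.
move=> [ps pE] [p's p'E]; have [|f fE] := factor_surj (g := p') ps.
  by move=> y /pE yi; apply/p'E; apply: seq_span_le.
exists f; split=> // [y|y]; first by have [z <-] := p's y; exists (p z).
have [z <-] := ps y; rewrite fE; split=> [/p'E[u /pE]|[u]].
  rewrite linearB linearZ => /eqP; rewrite subr_eq0 => /eqP ->.
  by exists (p u).
have [v <-] := ps u; rewrite -linearZ => zv; apply/p'E; exists v.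
by apply/pE; rewrite linearB zv subrr.
Qed.

Lemma seq_quot_regular M (x : nat -> A) i n Q (p : LinHom M Q) :
  weakly_regular M x n -> (i < n)%N -> seq_quot x i p ->
  forall y : Q, x i *: y = 0 -> y = 0.
Proof.
move=> xM lin [ps pE] y; have [z <-] := ps y.
by rewrite -linearZ => /pE/(xM i lin)/pE.
Qed.

Lemma seq_quot0_iso M (x : nat -> A) Q (p : LinHom M Q) : seq_quot x 0 p -> isomorphic M Q.
Proof.
by move=> [ps pE]; exists p; apply: bij_inj_surj ps; apply: ker0_inj => y /pE.
Qed.

(** The quotient of the ring by [i] regular elements has projective dimension at
    most [i]. *)
Lemma ext_zero_seq_quot_ring (x : nat -> A) n i Q (p : LinHom A^o Q) l :
  weakly_regular A^o x n -> (i <= n)%N -> seq_quot x i p -> (i < l)%N ->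
  ext_zero R l Q.
Proof.
move=> xA; elim: i l Q p => [|i IH] [//|l] Q p lin pq il.
  apply: ext_zero_iso (seq_quot0_iso pq) _.
  by apply: ext_zero_iso (row1_ring A) _; apply: ext_zero_row.
have [Q' [p' p'q]] := seq_quot_exists A^o x i.
have [f [_ fs fE]] := seq_quot_step p'q pq.
have x_lin : linear (fun y : Q' => x i *: y).
  by move=> a u v; rewrite scalerDr !scalerA mulrC.
have xf : short_exact (lin_of x_lin) f.
  by split=> //; apply: ker0_inj => y; apply: (seq_quot_regular xA lin p'q).
by apply: (ext_zero_quo xf); apply: IH p'q _ => //; apply: ltnW.
Qed.

(** Undoing the division by a regular element lowers by one the degree from which
    Ext vanishes. *)
Lemma ext_zero_seq_quot M (x : nat -> A) n s : finitely_generated M ->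
  (forall N l, finitely_generated N -> (s < l)%N -> ext_zero R l N) ->
  (forall i, m (x i)) -> weakly_regular M x n ->
  forall k i Q (p : LinHom M Q) l, (i + k)%N = n -> seq_quot x i p ->
  (s < l + k)%N -> ext_zero R l Q.
Proof.
move=> Mfg top mx xM; elim=> [|k IH] i Q p l ikn pq sl.
  by apply: top; [exact: seq_quot_fg pq Mfg | rewrite addn0 in sl].
have [Q' [p' p'q]] := seq_quot_exists M x i.+1.
have [f [_ fs fE]] := seq_quot_step pq p'q.
apply: (ext_zero_reg (seq_quot_fg pq Mfg) (mx i) _ fs fE).
  by apply: (seq_quot_regular xM _ pq); rewrite -ikn addnS ltnS leq_addr.
by apply: IH p'q _; rewrite addSnnS.
Qed.

(** The injective dimension of the ring is its depth: as long as the sequence is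
    shorter, the quotient of the ring contains no copy of the residue field,
    because Ext in the top degree vanishes on submodules of the quotient. *)
Lemma regular_sequence_exists s :
  (forall N l, finitely_generated N -> (s < l)%N -> ext_zero R l N) ->
  (0 < s)%N -> ~ (forall N, finitely_generated N -> ext_zero R s N) ->
  exists x : nat -> A, (forall i, m (x i)) /\ weakly_regular A^o x s.
Proof.
move=> top s_gt0 sN.
have [K Kres K0] : exists2 K, residue_module K & ~ ext_zero R s K.
  apply: contrapT => noK; apply: sN; apply: ext_zero_residue => [N Nfg|K Kres].
    exact: top.
  by apply: contrapT => K0; apply: noK; exists K.
suff x_ex j : (j <= s)%N -> exists x : nat -> A,
    (forall i, m (x i)) /\ weakly_regular A^o x j.
  exact: x_ex.
elim: j => [|j IH] js; first by exists (fun=> 0); split=> // i; apply: (local0 locm).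
have [x [mx xA]] := IH (ltnW js).
have [Q [p pq]] := seq_quot_exists A^o x j.
have A_fg : finitely_generated (A^o : lmodType A).
  exact: fg_iso (row1_ring A) (fg_row A 1).
have Qfg := seq_quot_fg pq A_fg.
have [||a ma a_reg] := @regular_element _ noethA m Q (local_ideal locm) => //.
  move=> z z0; apply: contrapT => zm; apply: K0.
  have zann a : a *: z = 0 <-> m a.
    split=> [az0|ma]; last by apply: contrapT => az0; apply: zm; exists a.
    apply: contrapT => /(local_unit noethA locm)[b ba]; apply: z0.
    by rewrite -[z]scale1r -ba -scalerA az0 scaler0.
  have [L [Q'' [i [q [iq Lfg Q''fg qE]]]]] := submod_exact noethA Qfg (cyclic_submod z).
  have [ii _ ip] := iq.
  have [u uE] : exists u, z = i u by apply/ip/qE; exists 1; rewrite scale1r.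
  apply: (@ext_zero_iso _ _ _ _ L).
    apply: residue_module_iso => //; exists u; split=> [y|a].
      have [|a aE] := (qE (i y)).2; first by apply/ip; exists y.
      by exists a; apply: ii; rewrite aE uE linearZ.
    split=> [au0|/zann]; first by apply/zann; rewrite uE -linearZ /= au0 linear0.
    by rewrite uE -linearZ => /(inj_ker0 ii).
  apply: (ext_zero_sub iq); first exact: ext_zero_seq_quot_ring xA (leqnn j) pq js.
  exact: top.
pose x' i := if i == j then a else x i.
have x'E i : (i < j)%N -> x' i = x i by rewrite /x' => /ltn_eqF ->.
have x'M i : (i <= j)%N -> seq_span x' i = seq_span x i :> set A^o.
  by move=> ij; apply: seq_span_ext => l li; apply: x'E; apply: leq_trans ij.
exists x'; split=> [i|i]; first by rewrite /x'; case: ifP.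
rewrite ltnS leq_eqVlt => /orP[/eqP ->|ij] y.
  rewrite x'M // /x' eqxx; case: pq => _ pE /pE.
  by rewrite linearZ => /a_reg/pE.
by rewrite x'M 1?ltnW // x'E //; apply: xA.
Qed.

End Depth.

(** Take for [s] the injective dimension, as the least degree above which Ext vanishes
    on finitely generated modules. *)
Lemma gorenstein_depth (A : comNzRingType) (m : set A) : gorenstein_local_ring m ->
  exists (R : coresolution (A^o : lmodType A)) s (x : nat -> A),
  [/\ forall N l, finitely_generated N -> (s < l)%N -> ext_zero R l N,
      forall i, m (x i) & weakly_regular A^o x s].
Proof.
move=> [noethA locm [n An]]; have [R Rn] := injective_cosyz An; exists R.
pose top s := forall N l, finitely_generated N -> (s < l)%N -> ext_zero R l N.
have ex_top : exists s, `[< top s >].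
  exists n; apply/asboolP => N l _ nl; exact: injective_ext_zero Rn _ _ nl.
case: (ex_minnP ex_top) => s /asboolP s_top s_min; exists s.
have [s0|s_gt0] := posnP s.
  by exists (fun=> 0); split=> // [i|i]; [apply: (local0 locm) | rewrite s0].
have [|x [mx xA]] := regular_sequence_exists noethA locm s_top s_gt0; last by exists x.
move=> sN; suff: (s <= s.-1)%N by rewrite leqNgt prednK // leqnn.
apply: s_min; apply/asboolP => N l Nfg; rewrite prednK // leq_eqVlt.
case/orP=> [/eqP <-|]; first exact: sN.
exact: s_top.
Qed.

(** * Duality and reflexivity *)

Section Duality.
Variable A : comNzRingType.
Implicit Types M N K : lmodType A.

Fact dual_map_linear M N (f : LinHom M N) :
  linear (fun g : dual N => lin_comp g f : dual M).
Proof. by move=> a g h; apply: LinHom_ext => x. Qed.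
Definition dual_map M N (f : LinHom M N) : LinHom (dual N) (dual M) :=
  lin_of (dual_map_linear f).

Lemma dual_mapE M N (f : LinHom M N) g x : dual_map f g x = g (f x). Proof. by []. Qed.

Lemma dual_iso M N : isomorphic M N -> isomorphic (dual M) (dual N).
Proof.
move=> [f /bij_inverse[g [fK gK]]]; exists (dual_map g); exists (dual_map f) => h;
  by apply: LinHom_ext => x; rewrite !dual_mapE ?fK ?gK.
Qed.

Fact dual_ev1_linear M (x : M) : linear (fun g : dual M => g x : A^o).
Proof. by []. Qed.
Fact dual_ev_linear M : linear (fun x : M => lin_of (dual_ev1_linear x) : dual (dual M)).
Proof. by move=> a x y; apply: LinHom_ext => g /=; rewrite linearP. Qed.
Definition dual_ev M : LinHom M (dual (dual M)) := lin_of (@dual_ev_linear M).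

Lemma dual_evE M x (g : dual M) : dual_ev M x g = g x. Proof. by []. Qed.

Fact row_form_linear n (v : 'rV[A]_n) :
  linear (fun w : 'rV[A]_n => \sum_j v 0 j * w 0 j : A^o).
Proof.
move=> a w w'; rewrite scaler_sumr -big_split; apply: eq_bigr => j _.
by rewrite !mxE mulrDr mulrCA.
Qed.
Definition row_form n (v : 'rV[A]_n) : dual 'rV[A]_n := lin_of (row_form_linear v).

Lemma row_formE n (v w : 'rV[A]_n) : row_form v w = \sum_j v 0 j * w 0 j.
Proof. by []. Qed.

Fact dual_out_linear n M (i : LinHom M 'rV[A]_n) :
  linear (fun v : 'rV[A]_n => lin_comp (row_form v) i : dual M).
Proof.
move=> a v w; apply: LinHom_ext => y /=; rewrite scaler_sumr -big_split.
by apply: eq_bigr => j _ /=; rewrite !mxE mulrDl -mulrA.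
Qed.
Definition dual_out n M (i : LinHom M 'rV[A]_n) : LinHom 'rV[A]_n (dual M) :=
  lin_of (dual_out_linear i).

Lemma dual_outE n M (i : LinHom M 'rV[A]_n) v y :
  dual_out i v y = \sum_j v 0 j * i y 0 j.
Proof. by []. Qed.

Fact dual_in_linear n M (p : LinHom 'rV[A]_n M) :
  linear (fun g : dual M => \row_j (g (p (delta_mx 0 j)) : A)).
Proof. by move=> a g h; apply/rowP => j; rewrite !mxE. Qed.
Definition dual_in n M (p : LinHom 'rV[A]_n M) : LinHom (dual M) 'rV[A]_n :=
  lin_of (dual_in_linear p).

Lemma dual_inE n M (p : LinHom 'rV[A]_n M) g j :
  dual_in p g 0 j = g (p (delta_mx 0 j)).
Proof. by rewrite mxE. Qed.

Lemma row_form_inE n M (p : LinHom 'rV[A]_n M) (g : dual M) (w : 'rV[A]_n) :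
  \sum_j dual_in p g 0 j * w 0 j = g (p w).
Proof.
rewrite (row_lin_sum p w) linear_sum; apply: eq_bigr => j _.
by rewrite dual_inE linearZ /= mulrC.
Qed.

Lemma form_row n (g : dual 'rV[A]_n) (w : 'rV[A]_n) :
  \sum_j (\row_j g (delta_mx 0 j) : 'rV[A]_n) 0 j * w 0 j = g w.
Proof.
rewrite (row_lin_sum g w); apply: eq_bigr => j _; by rewrite mxE mulrC.
Qed.

(** The dual of a presentation, with the free module identified with its dual, is
    exact as soon as forms extend from the kernel. *)
Lemma dual_short_exact n K M (i : LinHom K 'rV[A]_n) (p : LinHom 'rV[A]_n M) :
  short_exact i p -> (forall f : dual K, exists g : dual 'rV[A]_n, forall y, g (i y) = f y) ->
  short_exact (dual_in p) (dual_out i).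
Proof.
move=> [ii ps ip] ext; split.
- apply: ker0_inj => g /rowP g0; apply: LinHom_ext => y; have [w <-] := ps y.
  rewrite -row_form_inE big1 // => j _.
  by have := g0 j; rewrite [RHS]mxE => ->; rewrite mul0r.
- move=> f; have [g gE] := ext f; exists (\row_j g (delta_mx 0 j)).
  by apply: LinHom_ext => y; rewrite dual_outE form_row gE.
move=> v; split=> [v0|[g ->]]; last first.
  apply: LinHom_ext => y; rewrite dual_outE row_form_inE.
  by have /ip -> : exists z, i y = i z by [exists y]; rewrite linear0.
have [|g gE] := factor_surj (g := row_form v : LinHom _ A^o) ps.
  move=> w /ip[y ->]; exact: (congr1 (fun h : dual K => h y) v0).
exists g; apply/rowP => j; rewrite dual_inE gE row_formE (bigD1 j) //= big1.
  by rewrite mxE !eqxx mulr1 addr0.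
by move=> l lj; rewrite mxE (negPf lj) mulr0.
Qed.

Lemma seq_span_lift M N (p : LinHom M N) x i y :
  surj p -> seq_span x i (p y) -> exists2 g, seq_span x i g & p g = p y.
Proof.
move=> ps; elim: i y => [|i IH] y /=; first by move=> ->; exists 0; rewrite ?linear0.
move=> [z]; have [u <-] := ps z; rewrite -linearZ -linearB => /IH[g gi gE].
exists (g + x i *: u); first by exists u; rewrite addrK.
by rewrite linearD gE linearB subrK.
Qed.

(** The first Tor of the cokernel with [A/(x 0, ..., x n.-1)] vanishes. *)
Lemma seq_span_pure N F N' (i : LinHom N F) (p : LinHom F N') x n y :
  short_exact i p -> weakly_regular N' x n -> seq_span x n (i y) -> seq_span x n y.
Proof.
move=> [ii ps ip]; elim: n y => [|n IH] y xN' /=; first exact: inj_ker0.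
move=> [f fE]; have := seq_span_lin p fE.
have -> : p (i y - x n *: f) = x n *: p (- f).
  by rewrite linearB (_ : p (i y) = 0) ?sub0r ?linearN ?linearZ ?scalerN //; apply/ip; exists y.
move=> /(xN' n (ltnSn n)) /(seq_span_lift ps)[g gn gE].
have /ip[z zE] : p (f + g) = 0 by rewrite linearD gE -linearD subrr linear0.
exists z; apply: IH; first exact: weakly_regular_le xN'.
rewrite linearB linearZ /= -zE scalerDr opprD addrA.
by apply: submodB => //; [apply: submod_seq_span | apply: submodZ gn; apply: submod_seq_span].
Qed.

(** Regularity of [x l] on [N] only involves the [l] previous elements on the
    cokernel, so that a syzygy gains one regular element. *)
Lemma weakly_regular_syzygy N F N' (i : LinHom N F) (p : LinHom F N') x n :
  short_exact i p -> weakly_regular F x n.+1 -> weakly_regular N' x n ->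
  weakly_regular N x n.+1.
Proof.
move=> ip xF xN' l ln y /(seq_span_lin i); rewrite linearZ => /(xF l ln).
by apply: (seq_span_pure ip); apply: weakly_regular_le xN'.
Qed.

Lemma seq_span_row n x i (v : 'rV[A]_n) :
  seq_span x i v <-> forall j, seq_span x i (v 0 j : A^o).
Proof.
split=> [vi j|].
  have e_lin : linear (fun v : 'rV[A]_n => v 0 j : A^o) by move=> a u w; rewrite !mxE.
  exact: (seq_span_lin (lin_of e_lin) vi).
elim: i v => [|i IH] v /=; first by move=> v0; apply/rowP => j; rewrite v0 mxE.
move=> /choice[z zE]; exists (\row_j (z j : A)); apply: IH => j.
by rewrite !mxE.
Qed.

Lemma weakly_regular_row n x l :
  weakly_regular (A^o : lmodType A) x l -> weakly_regular 'rV[A]_n x l.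
Proof.
move=> xA i il v /seq_span_row vi; apply/seq_span_row => j; apply: (xA i il).
by have := vi j; rewrite mxE.
Qed.

Lemma regular_sequenceP (m : set A) M (x : nat -> A) n :
  regular_sequence m M (fun j : 'I_n => x j) <->
  [/\ forall j, (j < n)%N -> m (x j), weakly_regular M x n &
      exists y : M, ~ seq_span x n y].
Proof.
split=> [[mx xM [y yM]]|[mx xM [y yM]]]; split.
- by move=> j jn; apply: (mx (Ordinal jn)).
- move=> i il y' yi; apply/(in_ideal_mulE x y' (ltnW il)).
  by apply: (xM (Ordinal il)); apply/in_ideal_mulE => //; apply: ltnW.
- by exists y => /(in_ideal_mulE x y (leqnn n)).
- by move=> j; apply: mx.
- move=> i y' /in_ideal_mulE yi; apply/in_ideal_mulE; first exact: ltnW.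
  by apply: xM => //; apply: yi; apply: ltnW.
- by exists y => /in_ideal_mulE yn; apply: yM; apply: yn.
Qed.

Lemma extend_ord n (z : 'I_n -> A) : exists x : nat -> A, z = fun j : 'I_n => x j.
Proof.
exists (fun i => if insub i is Some j then z j else 0).
by apply: funext => j; rewrite valK.
Qed.

End Duality.

(** * Maximal Cohen-Macaulay modules over a Gorenstein ring *)

Section Acyclic.
Variables (A : comNzRingType) (R : coresolution (A^o : lmodType A)).
Implicit Types M N K : lmodType A.

(** [Ext^j(M,A) = 0] for all [j > 0]; over a Gorenstein ring these are the zero module
    and the maximal Cohen-Macaulay modules ([MCM_acyclic], [acyclic_MCM]). *)
Definition ext_acyclic M : Prop :=
  finitely_generated M /\ forall j, ext_zero R j.+1 M.

Lemma ext_acyclic_iso M N : isomorphic M N -> ext_acyclic M -> ext_acyclic N.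
Proof.
move=> MN [Mfg M0]; split; first exact: fg_iso MN Mfg.
by move=> j; apply: ext_zero_iso MN (M0 j).
Qed.

Lemma ext_acyclic_row n : ext_acyclic 'rV[A]_n.
Proof. by split; [apply: fg_row | move=> j; apply: ext_zero_row]. Qed.

Lemma ext_acyclic_syz n K M (i : LinHom K 'rV[A]_n) (p : LinHom 'rV[A]_n M) :
  noetherian A -> short_exact i p -> ext_acyclic M -> ext_acyclic K.
Proof.
move=> noethA ip [Mfg M0]; split.
  by apply: (fg_inj noethA (i := i)); [case: ip | apply: fg_row].
by move=> j; apply: (ext_zero_sub ip); [apply: ext_zero_row | apply: M0].
Qed.

Lemma extend_form M' M M'' (i : LinHom M' M) (p : LinHom M M'') (f : dual M') :
  short_exact i p -> ext_acyclic M'' -> exists g : dual M, forall y, g (i y) = f y.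
Proof.
move=> ip [_ M''0]; have [e /bij_inverse[e' [eK e'K]]] := cosyz0 R.
have [g gE] := ext_zero_extend (R := R) ip (lin_comp e f) (M''0 0).
by exists (lin_comp e' g) => y; rewrite /= gE /= eK.
Qed.

Lemma extend_row n M' M M'' (i : LinHom M' M) (p : LinHom M M'')
    (f : LinHom M' 'rV[A]_n) :
  short_exact i p -> ext_acyclic M'' ->
  exists g : LinHom M 'rV[A]_n, forall y, g (i y) = f y.
Proof.
move=> ip M''0.
have e_lin j : linear (fun v : 'rV[A]_n => v 0 j : A^o) by move=> a u v; rewrite !mxE.
have /choice[g gE] j : exists g : dual M, forall y, g (i y) = f y 0 j.
  exact: extend_form (lin_comp (lin_of (e_lin j)) f) ip M''0.
have g_lin : linear (fun x => \row_j (g j x : A)).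
  by move=> a x y; apply/rowP => j; rewrite !mxE linearP.
by exists (lin_of g_lin) => y; apply/rowP => j; rewrite mxE gE.
Qed.

Lemma dual_presentation n K M (i : LinHom K 'rV[A]_n) (p : LinHom 'rV[A]_n M) :
  short_exact i p -> ext_acyclic M -> short_exact (dual_in p) (dual_out i).
Proof. by move=> ip M0; apply: dual_short_exact => // f; apply: extend_form ip M0. Qed.

Fact pair_linear M N K (f : LinHom K M) (g : LinHom K N) : linear (fun x => (f x, g x)).
Proof. by move=> a x y; congr (_, _); apply: linearP. Qed.
Definition pair_lin M N K (f : LinHom K M) (g : LinHom K N) : LinHom K (M * N)%type :=
  lin_of (pair_linear f g).

Fact fst_linear M N : linear (fun z : M * N => z.1). Proof. by []. Qed.
Definition fst_lin M N : LinHom (M * N)%type M := lin_of (@fst_linear M N).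
Fact snd_linear M N : linear (fun z : M * N => z.2). Proof. by []. Qed.
Definition snd_lin M N : LinHom (M * N)%type N := lin_of (@snd_linear M N).

Lemma prod_short_exact M N : short_exact (pair_lin (lin_id M) (0 : LinHom M N)) (snd_lin M N).
Proof.
split=> [u v /(congr1 fst) //|y|[u v]]; first by exists (0, y).
by split=> [/= ->|[z [_ ->]]] //; exists u.
Qed.

Lemma ext_acyclic_prod M N : ext_acyclic M -> ext_acyclic N -> ext_acyclic (M * N)%type.
Proof.
move=> [Mfg M0] [Nfg N0]; split; last first.
  by move=> j; apply: (ext_zero_ext (prod_short_exact M N)).
have [n [g gs]] := (finitely_generatedP _).1 Mfg.
have [k [h hs]] := (finitely_generatedP _).1 Nfg.
have [g' g'E] := row_lin_cat g (0 : LinHom 'rV[A]_k M).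
have [h' h'E] := row_lin_cat (0 : LinHom 'rV[A]_n N) h.
apply/finitely_generatedP; exists (n + k)%N, (pair_lin g' h') => -[y z].
have [[u <-] [v <-]] := (gs y, hs z); exists (row_mx u v).
by congr (_, _); rewrite ?g'E ?h'E row_mxKl row_mxKr /= ?addr0 ?add0r.
Qed.

Lemma prod_comm M N : isomorphic (M * N)%type (N * M)%type.
Proof.
exists (pair_lin (snd_lin M N) (fst_lin M N)).
by exists (pair_lin (snd_lin N M) (fst_lin N M)) => -[].
Qed.

Lemma ext_acyclic_prodl M N : ext_acyclic (M * N)%type -> ext_acyclic M.
Proof.
move=> [MNfg MN0]; split.
  by apply: (fg_surj (f := fst_lin M N)) MNfg => u; exists (u, 0).
move=> j; apply: (ext_zero_retract (i := pair_lin (lin_id M) (0 : LinHom M N))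
  (r := fst_lin M N)) (MN0 j); by [].
Qed.

Lemma ext_acyclic_prodr M N : ext_acyclic (M * N)%type -> ext_acyclic N.
Proof. by move=> /(ext_acyclic_iso (prod_comm M N))/ext_acyclic_prodl. Qed.

End Acyclic.

Section Gorenstein.
Variables (A : comNzRingType) (m : set A) (R : coresolution (A^o : lmodType A)).
Variables (s : nat) (x : nat -> A).
Hypotheses (noethA : noetherian A) (locm : local_ring m).
Hypothesis top : forall N l, finitely_generated N -> (s < l)%N -> ext_zero R l N.
Hypotheses (mx : forall i, m (x i)) (xA : weakly_regular (A^o : lmodType A) x s).
Implicit Types M N K : lmodType A.
Local Notation acyclic := (ext_acyclic R).

(** The dual of an acyclic module is a syzygy of any order, hence as regular as
    the ring. *)
Lemma acyclic_dual_regular n M : (n <= s)%N -> acyclic M -> weakly_regular (dual M) x n.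
Proof.
elim: n M => [|n IH] M ns M0; first by [].
have [b [K [i [p [ip _]]]]] := fg_cover noethA (proj1 M0).
apply: (weakly_regular_syzygy (dual_presentation ip M0)).
  by apply: weakly_regular_row; apply: weakly_regular_le xA.
by apply: IH; [apply: ltnW | apply: ext_acyclic_syz ip M0].
Qed.

(** Ext vanishes above degree [s], and each of the [s] regular elements lowers this
    bound by one. *)
Lemma regular_acyclic M z : finitely_generated M -> (forall i, m (z i)) ->
  weakly_regular M z s -> acyclic M.
Proof.
move=> Mfg mz zM; split=> // j; have [Q [p pq]] := seq_quot_exists M z 0.
apply: ext_zero_iso (isomorphic_sym (seq_quot0_iso pq)) _.
apply: (ext_zero_seq_quot noethA locm Mfg top mz zM (add0n s) pq).
by rewrite addSn ltnS leq_addl.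
Qed.

Lemma acyclic_dual M : acyclic M -> acyclic (dual M).
Proof.
move=> M0; apply: regular_acyclic (mx) _; first exact: dual_fg (proj1 M0).
exact: acyclic_dual_regular.
Qed.

(** Dualizing a presentation twice gives a presentation of the bidual by the same
    free module. Comparing the two, the evaluation is onto; it is injective
    because the evaluation of the syzygy is onto. *)
Lemma acyclic_reflexive M : acyclic M -> bijective (dual_ev M).
Proof.
have ev_pres n N (p : LinHom 'rV[A]_n N) v :
    dual_out (dual_in p) v = dual_ev N (p v).
  apply: LinHom_ext => g; rewrite dual_outE dual_evE -row_form_inE.
  by apply: eq_bigr => j _; rewrite mulrC.
have ev_surj N : acyclic N -> surj (dual_ev N).
  move=> N0; have [b [K [i [p [ip _]]]]] := fg_cover noethA (proj1 N0).
  have [_ os _] := dual_presentation (dual_presentation ip N0)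
    (acyclic_dual (ext_acyclic_syz noethA ip N0)).
  by move=> y; have [v <-] := os y; exists (p v); rewrite -ev_pres.
move=> M0; apply: bij_inj_surj (ev_surj M M0); apply: ker0_inj => y.
have [b [K [i [p [ip _]]]]] := fg_cover noethA (proj1 M0).
have K0 := ext_acyclic_syz noethA ip M0.
have [_ _ oE] := dual_presentation (dual_presentation ip M0) (acyclic_dual K0).
have [v <-] : exists v, p v = y by case: ip.
rewrite -ev_pres => /oE[k ->]; have [z <-] := ev_surj K K0 k.
have -> : dual_in (dual_out i) (dual_ev K z) = i z.
  apply/rowP => j; rewrite dual_inE dual_evE dual_outE (bigD1 j) //= big1.
    by rewrite mxE !eqxx mul1r addr0.
  by move=> l lj; rewrite mxE (negPf lj) mul0r.
exact: short_exact0 ip.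
Qed.

Lemma acyclic_bidual M : acyclic M -> isomorphic M (dual (dual M)).
Proof. by move=> /acyclic_reflexive evb; exists (dual_ev M). Qed.

(** A reflexive module is a dual. *)
Lemma acyclic_regular M : acyclic M -> weakly_regular M x s.
Proof.
move=> M0; apply: (weakly_regular_iso (isomorphic_sym (acyclic_bidual M0))).
by apply: acyclic_dual_regular => //; apply: acyclic_dual.
Qed.

Lemma seq_span_max M z n (y : M) : (forall i, m (z i)) -> seq_span z n y -> max_ideal_mul m y.
Proof.
have ms := @submod_max_ideal_mul _ _ (local_ideal locm) M.
move=> mz; elim: n y => [|n IH] y /= => [->|[u /IH yu]]; first exact: submod0 ms.
by rewrite -(subrK (z n *: u) y); apply: (submodD ms yu); apply: max_ideal_mulZ.
Qed.

Lemma depth_le_dim d : krull_dim A d -> (s <= d)%N.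
Proof.
move=> Ad; apply: (regular_sequence_dim noethA locm Ad xA) => /(_ 1) /(seq_span_max mx).
move=> [n [a [z [ma e]]]]; apply: (local_proper locm); rewrite e.
apply: (submod_sum (M := A^o)); first by apply/is_ideal_submod; apply: local_ideal.
by move=> j _; rewrite [_ *: _]mulrC; apply: (localM locm).
Qed.

(** If the regular sequence of [M] were longer than [s], some quotient [Q] would
    be acyclic with zero dual, hence zero by reflexivity. *)
Lemma MCM_acyclic M : MCM m M -> acyclic M /\ krull_dim A s.
Proof.
move=> [Mfg [d [Ad [[z'] + _]]]]; have [z ->] := extend_ord z'.
move=> /regular_sequenceP[mz' zM [y yM]].
pose w i := if (i < d)%N then z i else 0.
have wz i : (i < d)%N -> z i = w i by rewrite /w => ->.
have mw i : m (w i) by rewrite /w; case: ifP => [/mz' //|_]; apply: (local0 locm).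
have wM : weakly_regular M w d.
  move=> i id u; rewrite -(seq_span_ext M (x := z)) -?wz //; first exact: zM.
  by move=> l li; apply: wz; apply: ltn_trans id.
have {}yM : ~ seq_span w d y by rewrite -(seq_span_ext M (x := z)).
have [ds|sd] := leqP d s.
  have sd : s = d by apply/eqP; rewrite eqn_leq ds andbT depth_le_dim.
  by split; [apply: regular_acyclic mw _; rewrite ?sd | rewrite sd].
have [Q [p pq]] := seq_quot_exists M w (d - s.+1).
have Q0 l : ext_zero R l Q.
  apply: (ext_zero_seq_quot noethA locm Mfg top mw wM _ pq (k := s.+1)).
    exact: subnK.
  by rewrite addnS ltnS leq_addl.
have Qa : acyclic Q by split=> [|l]; [exact: seq_quot_fg pq Mfg | apply: Q0].
have [e /bij_inverse[e' [eK e'K]]] := cosyz0 R.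
have dQ (g : dual Q) : g = 0.
  apply: LinHom_ext => u; have /= := Q0 0%N (lin_comp e g) u.
  by move=> /(congr1 e'); rewrite /= eK linear0.
case: yM; rewrite -(subnK sd); move: (d - s.+1)%N pq => i pq; elim: (s.+1) => [|l IH].
  rewrite addn0; case: pq => _ pE; apply/pE; apply: (bij_inj (acyclic_reflexive Qa)).
  by apply: LinHom_ext => g; rewrite (dQ g) !linear0.
by rewrite addnS; apply: seq_span_le.
Qed.

Hypothesis dim : krull_dim A s.

(** The sequence [x] witnesses that the depth is at least [s], and no sequence is
    longer than the dimension. *)
Lemma acyclic_MCM M : acyclic M -> (exists y : M, y <> 0) -> MCM m M.
Proof.
move=> M0 [y y0]; split; first by case: M0.
exists s; split=> //; split=> [|n z'].
  exists (fun j => x j); apply/regular_sequenceP; split=> //; first exact: acyclic_regular.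
  apply: contrapT => /forallNP xM; apply: y0.
  apply: (nakayama noethA locm (proj1 M0)) => u.
  by apply: (seq_span_max mx (n := s)); apply: contrapT; apply: xM.
have [z ->] := extend_ord z' => /regular_sequenceP[_ zM [u uM]].
by apply: (regular_sequence_dim noethA locm dim zM) => uz; apply: uM.
Qed.

End Gorenstein.

(** * Minimal syzygies *)

Section Syzygy.
Variables (A : comNzRingType) (m : set A).
Hypotheses (noethA : noetherian A) (locm : local_ring m).
Implicit Types M N K U V : lmodType A.

(** First syzygies are treated as a relation, because they are determined only up to
    isomorphism. *)
Definition syz1 M N : Prop :=
  exists b (i : LinHom N 'rV[A]_b) (p : LinHom 'rV[A]_b M),
    short_exact i p /\ forall y, max_ideal_mul m (i y).

(** The kernel of a minimal cover lies in [m F]: a relation with a unit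
    coefficient would make a generator redundant. *)
Lemma minimal_cover M : finitely_generated M ->
  exists b (p : LinHom 'rV[A]_b M), surj p /\ forall v, p v = 0 -> max_ideal_mul m v.
Proof.
move=> /finitely_generatedP Mfg.
have ex_b : exists b, `[< exists p : LinHom 'rV[A]_b M, surj p >].
  by have [b pb] := Mfg; exists b; apply/asboolP.
case: (ex_minnP ex_b) => b /asboolP[p ps] b_min; exists b, p; split=> // v pv0.
apply/(max_ideal_mul_row (local_ideal locm)) => j; apply: contrapT => vj.
have [c cv] := local_unit noethA locm vj.
case: b p ps b_min v pv0 j vj cv => [|b] p ps b_min v pv0 j vj cv; first by case: j vj cv.
have [q qE] := row_lin_delta (fun l => p (delta_mx 0 (lift j l))).
suff : (b.+1 <= b)%N by rewrite ltnn.
apply: b_min; apply/asboolP; exists q => y; have [w <-] := ps y.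
pose u := w - (w 0 j * c) *: v.
have -> : p w = p u by rewrite linearB linearZ /= pv0 scaler0 subr0.
exists (\row_l u 0 (lift j l)); rewrite !row_lin_sum [RHS](bigD1_ord j) //=.
rewrite [u 0 j]mxE !mxE -mulrA cv mulr1 subrr scale0r add0r.
by apply: eq_bigr => l _; rewrite qE mxE.
Qed.

Lemma syz1_exists M : finitely_generated M -> exists N, syz1 M N.
Proof.
move=> Mfg; have [b [p [ps pm]]] := minimal_cover Mfg.
have [K [i [ii Kfg iE]]] := submodule_exists noethA (fg_row A b) (submod_ker p).
exists K, b, i, p; split=> // y; by apply/pm/iE; exists y.
Qed.

Lemma syz1_isol M M' N : isomorphic M M' -> syz1 M N -> syz1 M' N.
Proof.
move=> [f fb] [b [i [p [[ii ps ip] im]]]]; exists b, i, (lin_comp f p).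
split=> //; split=> // [y|v].
  by have [z <-] := bij_surj fb y; have [v <-] := ps z; exists v.
split=> [/= /(inj_ker0 (bij_inj fb))/ip //|/ip pv /=]; by rewrite pv linear0.
Qed.

Lemma syz1_isor M N N' : isomorphic N N' -> syz1 M N -> syz1 M N'.
Proof.
move=> [f /bij_inverse[g [fK gK]]] [b [i [p [[ii ps ip] im]]]].
exists b, (lin_comp i g), p; split=> [|y]; last exact: im.
split=> [|//|v]; first exact: inj_comp ii (can_inj gK).
rewrite ip; split=> [[y ->]|[y ->]]; last by exists (g y).
by exists (f y); rewrite /= fK.
Qed.

(** Lifts of the identity of [M] between two minimal covers compose to
    endomorphisms that are the identity modulo [m]. *)
Lemma syz1_unique M N N' : syz1 M N -> syz1 M N' -> isomorphic N N'.
Proof.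
move=> [b [i [p [[ii ps ip] im]]]] [b' [i' [p' [[i'i p's ip'] i'm]]]].
have [h hE] := lift_free (g := p) (fun j => p's (p (delta_mx 0 j))).
have [h' h'E] := lift_free (g := p') (fun j => ps (p' (delta_mx 0 j))).
have h'h_bij : bijective (lin_comp h' h).
  apply: (id_mod_max_bij noethA locm (fg_row A b)) => v.
  have /ip[y ->] : p (v - h' (h v)) = 0 by rewrite linearB h'E hE subrr.
  exact: im.
have hh'_bij : bijective (lin_comp h h').
  apply: (id_mod_max_bij noethA locm (fg_row A b')) => v.
  have /ip'[y ->] : p' (v - h (h' v)) = 0 by rewrite linearB hE h'E subrr.
  exact: i'm.
have h_inj : injective h by move=> u v /(congr1 h') /(bij_inj h'h_bij).
have [|f fE] := factor_inj (g := lin_comp h i) i'i.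
  by move=> y; apply/ip'; rewrite /= hE; apply/ip; exists y.
exists f; apply: bij_inj_surj => [y z e|y'].
  by apply/ii/h_inj; have := congr1 i' e; rewrite !fE.
have [v vE] := bij_surj hh'_bij (i' y').
have /ip[y yE] : p (h' v) = 0 by rewrite -hE [h _]vE; apply/ip'; exists y'.
by exists y; apply: i'i; rewrite fE /= -yE.
Qed.

Lemma syz1_prod M N M' N' : syz1 M N -> syz1 M' N' -> syz1 (M * M')%type (N * N')%type.
Proof.
move=> [b [i [p [[ii ps ip] im]]]] [b' [i' [p' [[i'i p's ip'] i'm]]]].
have i0_lin : linear (fun y : N * N' => row_mx (i y.1) (i' y.2)).
  by move=> a y z; rewrite scale_row_mx add_row_mx -!linearP.
have [q qE] := row_lin_cat p (0 : LinHom 'rV[A]_b' M).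
have [q' q'E] := row_lin_cat (0 : LinHom 'rV[A]_b M') p'.
exists (b + b')%N, (lin_of i0_lin), (pair_lin q q'); split; last first.
  move=> y; apply/(max_ideal_mul_row (local_ideal locm)) => j; rewrite mxE.
  by case: (fintype.split j) => l; apply: (max_ideal_mul_row (local_ideal locm) _).1.
split=> [[y y'] [z z'] /= /eq_row_mx[/ii -> /i'i ->] //|[y y']|v].
  have [u uE] := ps y; have [u' u'E] := p's y'; exists (row_mx u u').
  by congr (_, _); rewrite ?qE ?q'E row_mxKl row_mxKr /= ?addr0 ?add0r.
rewrite -[v]hsubmxK; move: (lsubmx v) (rsubmx v) => u u'.
have -> : pair_lin q q' (row_mx u u') = (p u, p' u').
  by congr (_, _); rewrite ?qE ?q'E row_mxKl row_mxKr /= ?addr0 ?add0r.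
split=> [[/ip[y ->] /ip'[y' ->]]|[[y y'] /eq_row_mx[-> ->]]]; first by exists (y, y').
congr (_, _); first by apply/ip; exists y.
by apply/ip'; exists y'.
Qed.

(** A module with zero syzygy is free. *)
Lemma syz1_zero M N : finitely_generated M -> no_free_quotient m M -> syz1 M N ->
  (forall y : N, y = 0) -> forall z : M, z = 0.
Proof.
move=> Mfg Mnf [b [i [p [[ii ps ip] im]]]] N0; apply: (nakayama noethA locm Mfg) => z.
have p_bij : bijective p.
  apply: bij_inj_surj => //; apply: ker0_inj => v /ip[y ->].
  by rewrite (N0 y) linear0.
have [q [pK qK]] := bij_inverse p_bij.
rewrite -[z]qK; apply: max_ideal_mul_lin.
exact: (no_free_quotient_row (local_ideal locm) q Mnf z).
Qed.

End Syzygy.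

Section StableModules.
Variables (A : comNzRingType) (m : set A) (R : coresolution (A^o : lmodType A)).
Variables (s : nat) (x : nat -> A).
Hypotheses (noethA : noetherian A) (locm : local_ring m).
Hypothesis top : forall N l, finitely_generated N -> (s < l)%N -> ext_zero R l N.
Hypotheses (mx : forall i, m (x i)) (xA : weakly_regular (A^o : lmodType A) x s).
Implicit Types M N K U V : lmodType A.
Local Notation acyclic := (ext_acyclic R).
Let bidual M : acyclic M -> isomorphic M (dual (dual M)) :=
  acyclic_bidual noethA locm top mx xA (M := M).
Let ac_dual M : acyclic M -> acyclic (dual M) :=
  acyclic_dual noethA locm top mx xA (M := M).

(** The dual of a minimal presentation is minimal because forms on a module without
    free summand take values in [m]. *)
Lemma syz1_dual M N : acyclic M -> no_free_quotient m M -> syz1 m M N ->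
  syz1 m (dual N) (dual M).
Proof.
move=> M0 Mnf [b [i [p [ip im]]]]; exists b, (dual_in p), (dual_out i).
split; first exact: dual_presentation ip M0.
by move=> g; apply/(max_ideal_mul_row (local_ideal locm)) => j; rewrite dual_inE; apply: Mnf.
Qed.

Lemma syz1_acyclic M N : acyclic M -> syz1 m M N -> acyclic N.
Proof. by move=> M0 [b [i [p [ip im]]]]; apply: ext_acyclic_syz ip M0. Qed.

(** Forms on a syzygy extend to the free cover, where the syzygy lies in [m F]. *)
Lemma syz1_no_free_quotient M N : acyclic M -> syz1 m M N -> no_free_quotient m N.
Proof.
move=> M0 [b [i [p [ip im]]]] f y; have [g <-] := extend_form f ip M0.
have [n [a [z [ma ->]]]] := max_ideal_mul_lin g (im y).
apply: (submod_sum (M := A^o)) => [|j _]; first by apply/is_ideal_submod; apply: local_ideal.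
by rewrite [_ *: _]mulrC; apply: (localM locm).
Qed.

Lemma dual_zero M : acyclic M -> (forall g : dual M, g = 0) -> forall y : M, y = 0.
Proof.
move=> M0 g0 y; apply: (bij_inj (acyclic_reflexive noethA locm top mx xA M0)).
by apply: LinHom_ext => g; rewrite (g0 g) !linear0.
Qed.

Lemma dual_no_free_quotient M : acyclic M -> no_free_quotient m M ->
  no_free_quotient m (dual M).
Proof.
move=> M0 Mnf f g.
have [y <-] := bij_surj (acyclic_reflexive noethA locm top mx xA M0) f.
exact: Mnf.
Qed.

Lemma dual_prod M N : isomorphic (dual (M * N)%type) (dual M * dual N)%type.
Proof.
pose inl := pair_lin (lin_id M) (0 : LinHom M N).
pose inr := pair_lin (0 : LinHom N M) (lin_id N).
exists (pair_lin (dual_map inl) (dual_map inr)).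
exists (fun g => dual_map (fst_lin M N) g.1 + dual_map (snd_lin M N) g.2) => [g|[g h]].
  apply: LinHom_ext => -[y z]; rewrite -[LHS]/(g (y, 0) + g (0, z)) -linearD.
  by congr (g (_, _)); rewrite ?addr0 ?add0r.
congr (_, _); apply: LinHom_ext => y.
  by rewrite -[LHS]/(g y + h 0) linear0 addr0.
by rewrite -[LHS]/(g 0 + h y) linear0 add0r.
Qed.

(** ** Indecomposable maximal Cohen-Macaulay modules that are not free *)

(** The vertices of the stable quiver ([stable_modP]), described without depth and in
    a form invariant under duality and syzygies. *)
Definition stable_mod M : Prop :=
  [/\ acyclic M, no_free_quotient m M & indecomposable M].

Lemma indecomposable_iso M N : isomorphic M N -> indecomposable M -> indecomposable N.
Proof.
move=> MN [[y y0] Mind]; split=> [|U V NUV].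
  by have [f /bij_inj fi] := MN; exists (f y); move=> /(inj_ker0 fi).
by apply: Mind; apply: isomorphic_trans NUV.
Qed.

Lemma stable_mod_iso M N : isomorphic M N -> stable_mod M -> stable_mod N.
Proof.
move=> MN [M0 Mnf Mind]; split; first exact: ext_acyclic_iso MN M0.
  exact: no_free_quotient_iso MN Mnf.
exact: indecomposable_iso MN Mind.
Qed.

(** A decomposition of [M*] dualizes to one of [M**]. *)
Lemma stable_mod_dual M : stable_mod M -> stable_mod (dual M).
Proof.
move=> [M0 Mnf [[y y0] Mind]]; split; [exact: ac_dual | exact: dual_no_free_quotient |].
split=> [|U V dMUV].
  apply: contrapT => /forallNP g0; apply: y0; apply: (dual_zero M0) => g.
  by apply: contrapT; apply: g0.
have UV0 : acyclic (U * V)%type by apply: ext_acyclic_iso dMUV _; apply: ac_dual.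
have M_UV : isomorphic M (dual U * dual V)%type.
  apply: isomorphic_trans (bidual M0) _; apply: isomorphic_trans (dual_prod U V).
  exact: isomorphic_sym (dual_iso (isomorphic_sym _)).
by have [/(dual_zero (ext_acyclic_prodl UV0))|/(dual_zero (ext_acyclic_prodr UV0))] :=
  Mind _ _ M_UV; [left|right].
Qed.

(** A decomposition of the syzygy [N] induces one of the syzygy [M*] of [N*]. *)
Lemma stable_mod_syz M N : stable_mod M -> syz1 m M N -> stable_mod N.
Proof.
move=> Ms MN; have [M0 Mnf [[y y0] Mind]] := Ms.
have N0 := syz1_acyclic M0 MN; split; [by []|exact: syz1_no_free_quotient MN |].
have Nnf := syz1_no_free_quotient M0 MN.
split=> [|U V NUV].
  apply: contrapT => /forallNP Nz; apply: y0.
  apply: (syz1_zero noethA locm (proj1 M0) Mnf MN) => z.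
  by apply: contrapT; apply: Nz.
have UV0 := ext_acyclic_iso NUV N0.
have UVnf := no_free_quotient_iso NUV Nnf.
have U0 := ext_acyclic_prodl UV0; have V0 := ext_acyclic_prodr UV0.
have Unf : no_free_quotient m U.
  by apply: (no_free_quotient_surj (f := fst_lin U V)) UVnf => u; exists (u, 0).
have Vnf : no_free_quotient m V.
  by apply: (no_free_quotient_surj (f := snd_lin U V)) UVnf => v; exists (0, v).
have [K UK] := syz1_exists noethA locm (proj1 (ac_dual U0)).
have [L VL] := syz1_exists noethA locm (proj1 (ac_dual V0)).
have KL : isomorphic (dual M) (K * L)%type.
  apply: (syz1_unique noethA locm (syz1_dual M0 Mnf MN)).
  apply: syz1_isol (syz1_prod locm UK VL).
  apply: isomorphic_trans (isomorphic_sym (dual_prod U V)) _.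
  exact: dual_iso (isomorphic_sym NUV).
have [_ _ [_ dMind]] := stable_mod_dual Ms.
case: (dMind _ _ KL) => [K0|L0]; [left|right].
  apply: (dual_zero U0); apply: (syz1_zero noethA locm _ _ UK K0).
    exact: proj1 (ac_dual U0).
  exact: dual_no_free_quotient.
apply: (dual_zero V0); apply: (syz1_zero noethA locm _ _ VL L0).
  exact: proj1 (ac_dual V0).
exact: dual_no_free_quotient.
Qed.

Lemma stable_syz_exists M : stable_mod M -> exists N, stable_mod N /\ syz1 m M N.
Proof.
move=> Ms; have [[Mfg _] _ _] := Ms; have [N MN] := syz1_exists noethA locm Mfg.
by exists N; split=> //; apply: stable_mod_syz MN.
Qed.

Lemma stable_syz_dual M N : stable_mod M -> syz1 m M N -> syz1 m (dual N) (dual M).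
Proof. by case=> M0 Mnf _; apply: syz1_dual. Qed.

Lemma stable_bidual M : stable_mod M -> isomorphic M (dual (dual M)).
Proof. by case=> M0 _ _; apply: bidual. Qed.

(** A cosyzygy is the dual of a syzygy of the dual. *)
Lemma stable_cosyz_exists N : stable_mod N -> exists M, stable_mod M /\ syz1 m M N.
Proof.
move=> Ns; have [K [Ks NK]] := stable_syz_exists (stable_mod_dual Ns).
exists (dual K); split; first exact: stable_mod_dual.
apply: syz1_isor (isomorphic_sym (stable_bidual Ns)) _.
by apply: stable_syz_dual => //; apply: stable_mod_dual.
Qed.

Lemma syz1_inj M M' N : stable_mod M -> stable_mod M' ->
  syz1 m M N -> syz1 m M' N -> isomorphic M M'.
Proof.
move=> Ms M's MN M'N; apply: isomorphic_trans (stable_bidual Ms) _.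
apply: isomorphic_trans (isomorphic_sym (stable_bidual M's)).
apply: dual_iso; apply: (syz1_unique noethA locm (M := dual N));
  exact: stable_syz_dual.
Qed.

Hypothesis dim : krull_dim A s.

(** If a form on [M] takes the value [1] at [e], then [M] is the direct sum of [A e] and
    the kernel of the form. *)
Lemma stable_modP M : stable_mod M <->
  indecomposable_MCM m M /\ ~ isomorphic M (A^o : lmodType A).
Proof.
split=> [[M0 Mnf Mind]|[[MMCM Mind] MA]].
  split; last first.
    move=> [f /bij_surj fs]; have [y fy] := fs 1.
    by apply: (local_proper locm); rewrite -fy; apply: Mnf.
  by split=> //; apply: (acyclic_MCM noethA locm top mx xA dim M0); case: Mind.
have [M0 _] := MCM_acyclic noethA locm top mx xA MMCM; split=> // f y.
apply: contrapT => /(local_unit noethA locm)[b bf]; apply: MA.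
have [e fe] : exists e, f e = 1 by exists (b *: y); rewrite linearZ.
have [K [i [ii _ iE]]] := submodule_exists noethA (proj1 M0) (submod_ker f).
have [h hE] : exists h : LinHom M M, forall z, h z = z - f z *: e.
  apply: lin_exists => a z w; rewrite linearP scalerDl scalerBr scalerA.
  by rewrite opprD addrACA.
have [|g gE] := factor_inj (g := h) ii.
  by move=> z; apply/iE; rewrite /= hE linearB linearZ /= fe [_ *: _]mulr1 subrr.
have fi k : f (i k) = 0 by apply/iE; exists k.
have fg_bij : bijective (pair_lin f g).
  apply: bij_inj_surj => [|[a k]].
    apply: ker0_inj => z [fz gz]; have := gE z.
    by rewrite gz hE fz linear0 scale0r subr0.
  have fz : f (a *: e + i k) = a by rewrite linearD linearZ /= fe fi addr0 [_ *: _]mulr1.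
  exists (a *: e + i k); congr (_, _); first exact: fz.
  by apply: ii; rewrite gE hE fz addrC addKr.
have [_ Mi] := Mind; case: (Mi _ _ (ex_intro _ _ fg_bij)) => [A0|K0].
  by case: (local_proper locm); rewrite (A0 1); apply: (local0 locm).
exists f; apply: bij_inj_surj => [|a]; last by exists (a *: e); rewrite linearZ /= fe [_ *: _]mulr1.
apply: ker0_inj => z fz; have := gE z.
by rewrite (K0 (g z)) hE fz linear0 scale0r subr0.
Qed.

End StableModules.

(** * Syzygies preserve irreducible maps *)

Section Lifts.
Variable A : comNzRingType.
Implicit Types M N : lmodType A.

(** The correspondence between [Hom(M,M')] and [Hom(N,N')] that underlies the syzygy
    functor on stable categories: it is total in both directions, and single-valued
    up to maps that factor through a free module. *)
Definition compatible b M N (i : LinHom N 'rV[A]_b) (p : LinHom 'rV[A]_b M)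
    b' M' N' (i' : LinHom N' 'rV[A]_b') (p' : LinHom 'rV[A]_b' M')
    (f : LinHom M M') (g : LinHom N N') : Prop :=
  exists h : LinHom 'rV[A]_b 'rV[A]_b',
    (forall y, h (i y) = i' (g y)) /\ (forall v, p' (h v) = f (p v)).

Lemma compatible_id b M N (i : LinHom N 'rV[A]_b) (p : LinHom 'rV[A]_b M) :
  compatible i p i p (lin_id M) (lin_id N).
Proof. by exists (lin_id _). Qed.

Section Pair.
Variables (b : nat) (M N : lmodType A) (i : LinHom N 'rV[A]_b) (p : LinHom 'rV[A]_b M).
Variables (b' : nat) (M' N' : lmodType A).
Variables (i' : LinHom N' 'rV[A]_b') (p' : LinHom 'rV[A]_b' M').
Hypotheses (ip : short_exact i p) (ip' : short_exact i' p').
Local Notation T := (compatible i p i' p').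

Lemma compatible_comp c K L (j : LinHom L 'rV[A]_c) (q : LinHom 'rV[A]_c K) f g f' g' :
  T f g -> compatible i' p' j q f' g' -> compatible i p j q (lin_comp f' f) (lin_comp g' g).
Proof.
move=> [h [hi hp]] [h' [h'i h'p]]; exists (lin_comp h' h).
by split=> [y|v] /=; rewrite ?hi ?h'i // h'p hp.
Qed.

Lemma compatible_lin n (a : 'I_n -> A) (f : 'I_n -> LinHom M M')
    (g : 'I_n -> LinHom N N') :
  (forall l, T (f l) (g l)) -> T (\sum_l a l *: f l) (\sum_l a l *: g l).
Proof.
move=> /choice[h hT]; exists (\sum_l a l *: h l); split=> z; rewrite !LinHom_sumE linear_sum;
  apply: eq_bigr => l _ /=; rewrite linearZ; by case: (hT l) => [hi hp]; rewrite ?hi ?hp.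
Qed.

Lemma compatible_sub f g f' g' : T f g -> T f' g' -> T (f - f') (g - g').
Proof.
move=> [h [hi hp]] [h' [h'i h'p]]; exists (h - h').
by split=> [y|v] /=; rewrite linearB ?hi ?h'i ?hp ?h'p.
Qed.

Lemma compatible_down f : exists g, T f g.
Proof.
have [ii ps ipE] := ip; have [i'i p's i'pE] := ip'.
have [h hE] := lift_free (g := lin_comp f p) (fun l => p's (f (p (delta_mx 0 l)))).
have [|g gE] := factor_inj (g := lin_comp h i) i'i.
  by move=> y; apply/i'pE; rewrite /= hE /= (short_exact0 _ ip) linear0.
by exists g, h; split=> [y|v]; [rewrite gE | rewrite hE].
Qed.

Lemma compatible_up (R : coresolution (A^o : lmodType A)) g : ext_acyclic R M ->
  exists f, T f g.
Proof.
move=> M0; have [ii ps ipE] := ip.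
have [h hE] := extend_row (lin_comp i' g) ip M0.
have [|f fE] := factor_surj (g := lin_comp p' h) ps.
  by move=> v /ipE[y ->]; rewrite /= hE /= (short_exact0 _ ip').
by exists f, h; split=> [y|v]; [rewrite hE | rewrite fE].
Qed.

Lemma compatible_zero_left f g : T f g -> (forall y, f y = 0) ->
  exists e : LinHom 'rV[A]_b N', forall y, g y = e (i y).
Proof.
move=> [h [hi hp]] f0; have [i'i _ i'pE] := ip'.
have [|e eE] := factor_inj (g := h) i'i.
  by move=> v; apply/i'pE; rewrite hp f0.
by exists e => y; apply: i'i; rewrite eE hi.
Qed.

Lemma compatible_zero_right f g : T f g -> (forall y, g y = 0) ->
  exists e : LinHom M 'rV[A]_b', forall z, f z = p' (e z).
Proof.
move=> [h [hi hp]] g0; have [_ ps ipE] := ip.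
have [|e eE] := factor_surj (g := h) ps.
  by move=> v /ipE[y ->]; rewrite hi g0 linear0.
by exists e => z; have [v <-] := ps z; rewrite eE hp.
Qed.

End Pair.
End Lifts.

Section NearIdentity.
Variables (A : comNzRingType) (m : set A).
Hypotheses (noethA : noetherian A) (locm : local_ring m).
Implicit Types M N : lmodType A.

Lemma bij_split_mono M N (u : LinHom M N) (r : LinHom N M) :
  bijective (lin_comp r u) -> split_mono u.
Proof. by move=> /bij_inverse[q [qK _]]; exists (lin_comp q r). Qed.

Lemma bij_split_epi M N (v : LinHom M N) (s : LinHom N M) :
  bijective (lin_comp v s) -> split_epi v.
Proof. by move=> /bij_inverse[q [_ qK]]; exists (lin_comp s q). Qed.

Lemma bij_lr M N (f : LinHom M N) (g : LinHom N M) :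
  bijective (lin_comp g f) -> bijective (lin_comp f g) -> bijective f.
Proof.
move=> gf fg; apply: bij_inj_surj => [y z e|y].
  by apply: (bij_inj gf); rewrite /= e.
by have [z zE] := bij_surj fg y; exists (g z).
Qed.

(** A module without free summand goes to [m F] in a free module [F]. *)
Lemma through_free_max b M N (a : LinHom M 'rV[A]_b) (e : LinHom 'rV[A]_b N) y :
  no_free_quotient m M -> max_ideal_mul m (e (a y)).
Proof.
by move=> Mnf; apply: max_ideal_mul_lin; apply: (no_free_quotient_row (local_ideal locm)).
Qed.

Variables (b : nat) (M N : lmodType A) (i : LinHom N 'rV[A]_b) (p : LinHom 'rV[A]_b M).
Hypothesis ip : short_exact i p.

(** If one of two compatible endomorphisms is the identity, then the other is
    bijective, since its difference with the identity factors through a free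
    module. *)
Lemma compatible_id_down f g : finitely_generated N -> no_free_quotient m N ->
  compatible i p i p f g -> (forall z, f z = z) -> bijective g.
Proof.
move=> Nfg Nnf fg fid.
have [|e eE] := compatible_zero_left ip (compatible_sub (compatible_id i p) fg).
  by move=> z /=; rewrite fid subrr.
apply: (id_mod_max_bij noethA locm Nfg) => y.
by rewrite -[y - g y]/((lin_id N - g : LinHom N N) y) eE; apply: through_free_max.
Qed.

Lemma compatible_id_up f g : finitely_generated M -> no_free_quotient m M ->
  compatible i p i p f g -> (forall y, g y = y) -> bijective f.
Proof.
move=> Mfg Mnf fg gid.
have [|e eE] := compatible_zero_right ip (compatible_sub (compatible_id i p) fg).
  by move=> z /=; rewrite gid subrr.
apply: (id_mod_max_bij noethA locm Mfg) => y.
by rewrite -[y - f y]/((lin_id M - f : LinHom M M) y) eE; apply: through_free_max.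
Qed.

End NearIdentity.

Section Irreducible.
Variables (A : comNzRingType) (m : set A) (R : coresolution (A^o : lmodType A)).
Variables (s : nat) (x : nat -> A).
Hypotheses (noethA : noetherian A) (locm : local_ring m).
Hypothesis top : forall N l, finitely_generated N -> (s < l)%N -> ext_zero R l N.
Hypotheses (mx : forall i, m (x i)) (xA : weakly_regular (A^o : lmodType A) x s).
Hypothesis dim : krull_dim A s.
Implicit Types M N K X : lmodType A.
Local Notation acyclic := (ext_acyclic R).
Local Notation stable := (stable_mod m R).

(** Dualize a presentation of the dual. *)
Lemma cosyzygy_exists N : acyclic N -> exists b M (i : LinHom N 'rV[A]_b) (p : LinHom 'rV[A]_b M),
  short_exact i p /\ acyclic M.
Proof.
move=> N0; have dN0 := acyclic_dual noethA locm top mx xA N0.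
have [b [K [i [p [ip Kfg]]]]] := fg_cover noethA (proj1 dN0).
have [ii ps ipE] := dual_presentation ip dN0.
have [e eb] := acyclic_bidual noethA locm top mx xA N0.
exists b, (dual K), (lin_comp (dual_in p) e), (dual_out i); split.
  split=> // [|v]; first exact: inj_comp ii (bij_inj eb).
  split=> [/ipE[y ->]|[y ->]]; last by apply/ipE; exists (e y).
  by have [z <-] := bij_surj eb y; exists z.
apply: (acyclic_dual noethA locm top mx xA).
exact: ext_acyclic_syz ip dN0.
Qed.

(** A composite through [X] plus a map through a free module is a composite through
    their direct sum. A splitting of the first or last map would, modulo [m], split
    [u] or [v] already. *)
Lemma hom2_add_free M M' X c (f : LinHom M M') (u : LinHom M X) (v : LinHom X M')
    (a : LinHom M 'rV[A]_c) (e : LinHom 'rV[A]_c M') :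
  stable M -> stable M' -> acyclic X -> (exists w : 'rV[A]_c, w <> 0) ->
  ~ split_mono u -> ~ split_epi v -> (forall y, f y = v (u y) + e (a y)) ->
  hom2 m f.
Proof.
move=> [[Mfg _] Mnf _] [[M'fg _] M'nf _] X0 [w w0] un vn fE.
exists (X * 'rV[A]_c)%type, (pair_lin u a),
  (lin_comp v (fst_lin X 'rV[A]_c) + lin_comp e (snd_lin X 'rV[A]_c)); split.
- apply: (acyclic_MCM noethA locm top mx xA dim).
    exact: ext_acyclic_prod X0 (ext_acyclic_row R c).
  by exists (0, w) => -[].
- move=> [r rE]; apply: un.
  pose r1 := lin_comp r (pair_lin (lin_id X) (0 : LinHom X 'rV[A]_c)).
  pose r2 := lin_comp r (pair_lin (0 : LinHom 'rV[A]_c X) (lin_id _)).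
  apply: (bij_split_mono (r := r1)).
  apply: (id_mod_max_bij noethA locm Mfg) => y.
  suff -> : y - lin_comp r1 u y = r2 (a y) by apply: through_free_max.
  rewrite -{1}[y]rE /= -linearB; congr (r (_, _)); by rewrite ?subrr ?subr0.
- move=> [t tE]; apply: vn.
  apply: (bij_split_epi (s := lin_comp (fst_lin X 'rV[A]_c) t)).
  apply: (id_mod_max_bij noethA locm M'fg) => y.
  suff -> : y - v (t y).1 = e (lin_comp (snd_lin X 'rV[A]_c) t y).
    exact: through_free_max.
  by rewrite -{1}[y]tE /= addrC addKr.
- by [].
Qed.

Section Transfer.
Variables (b : nat) (M N : lmodType A) (i : LinHom N 'rV[A]_b) (p : LinHom 'rV[A]_b M).
Variables (b' : nat) (M' N' : lmodType A).
Variables (i' : LinHom N' 'rV[A]_b') (p' : LinHom 'rV[A]_b' M').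
Hypotheses (ip : short_exact i p) (ip' : short_exact i' p').
Hypotheses (Ms : stable M) (M's : stable M') (Ns : stable N) (N's : stable N').

Let M0 : acyclic M. Proof. by case: Ms. Qed.
Let M'0 : acyclic M'. Proof. by case: M's. Qed.

(** A map compatible with the inverse of one of the two is inverse to the other
    modulo maps through free modules. *)
Lemma hom1_compatible f g : compatible i p i' p' f g -> hom1 f <-> hom1 g.
Proof.
have [[Mfg _] Mnf _] := Ms; have [[M'fg _] M'nf _] := M's.
have [[Nfg _] Nnf _] := Ns; have [[N'fg _] N'nf _] := N's.
move=> fg; suff : bijective f <-> bijective g by rewrite /hom1 => ->.
split=> [/bij_inverse[f' [fK f'K]]|/bij_inverse[g' [gK g'K]]].
  have [g' fg'] := compatible_down ip' ip f'.
  apply: (bij_lr (g := g')).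
    exact: (compatible_id_down noethA locm ip Nfg Nnf (compatible_comp fg fg')).
  exact: (compatible_id_down noethA locm ip' N'fg N'nf (compatible_comp fg' fg)).
have [f' fg'] := compatible_up ip' ip g' M'0.
apply: (bij_lr (g := f')).
  exact: (compatible_id_up noethA locm ip Mfg Mnf (compatible_comp fg fg')).
exact: (compatible_id_up noethA locm ip' M'fg M'nf (compatible_comp fg' fg)).
Qed.

Let row_nonzero c K L (j : LinHom L 'rV[A]_c) (q : LinHom 'rV[A]_c K) :
  short_exact j q -> stable L -> exists w : 'rV[A]_c, w <> 0.
Proof.
by move=> [ji _ _] [_ _ [[y y0] _]]; exists (j y) => /(inj_ker0 ji).
Qed.

(** Take syzygies of a factorization: the syzygies of the factors compose to [g] up to
    a map through a free module, and a splitting of either would lift back. *)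
Lemma hom2_down f g : compatible i p i' p' f g -> hom2 m f -> hom2 m g.
Proof.
have [[Mfg _] Mnf _] := Ms; have [[M'fg _] M'nf _] := M's.
move=> fg [X [u [v [XMCM un vn fE]]]].
have [X0 _] := MCM_acyclic noethA locm top mx xA XMCM.
have [c [K [j [q [jq _]]]]] := fg_cover noethA (proj1 X0).
have [u1 uu1] := compatible_down ip jq u; have [v1 vv1] := compatible_down jq ip' v.
have [|e eE] := compatible_zero_left ip' (compatible_sub fg (compatible_comp uu1 vv1)).
  by move=> y /=; rewrite fE subrr.
apply: (hom2_add_free (u := u1) (v := v1) (a := i) (e := e)) => //.
- exact: ext_acyclic_syz jq X0.
- exact: row_nonzero ip Ns.
- move=> [r rE]; apply: un; have [r' rr'] := compatible_up jq ip r X0.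
  apply: (bij_split_mono (r := r')).
  exact: (compatible_id_up noethA locm ip Mfg Mnf (compatible_comp uu1 rr')).
- move=> [t tE]; apply: vn; have [t' tt'] := compatible_up ip' jq t M'0.
  apply: (bij_split_epi (s := t')).
  exact: (compatible_id_up noethA locm ip' M'fg M'nf (compatible_comp tt' vv1)).
- by move=> y; rewrite -eE /= subrKC.
Qed.

(** The same argument with a cosyzygy of the middle term. *)
Lemma hom2_up f g : compatible i p i' p' f g -> hom2 m g -> hom2 m f.
Proof.
have [[Nfg _] Nnf _] := Ns; have [[N'fg _] N'nf _] := N's.
move=> fg [K [u1 [v1 [KMCM un vn gE]]]].
have [K0 _] := MCM_acyclic noethA locm top mx xA KMCM.
have [c [X [j [q [jq X0]]]]] := cosyzygy_exists K0.
have [u uu1] := compatible_up ip jq u1 M0; have [v vv1] := compatible_up jq ip' v1 X0.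
have [|e eE] := compatible_zero_right ip (compatible_sub fg (compatible_comp uu1 vv1)).
  by move=> y /=; rewrite gE subrr.
apply: (hom2_add_free (u := u) (v := v) (a := e) (e := p')) => //.
- exact: row_nonzero ip' N's.
- move=> [r rE]; apply: un; have [r' rr'] := compatible_down jq ip r.
  apply: (bij_split_mono (r := r')).
  exact: (compatible_id_down noethA locm ip Nfg Nnf (compatible_comp uu1 rr')).
- move=> [t tE]; apply: vn; have [t' tt'] := compatible_down ip' jq t.
  apply: (bij_split_epi (s := t')).
  exact: (compatible_id_down noethA locm ip' N'fg N'nf (compatible_comp tt' vv1)).
- by move=> y; rewrite -eE /= subrKC.
Qed.

End Transfer.

(** A linear correspondence that is total in both directions and matches the
    non-isomorphisms and the decomposable maps carries a basis to a basis. *)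
Lemma irr_dim_transfer M M' N N' (T : LinHom M M' -> LinHom N N' -> Prop) n :
  (forall f, exists g, T f g) -> (forall g, exists f, T f g) ->
  (forall k a (f : 'I_k -> LinHom M M') (g : 'I_k -> LinHom N N'),
     (forall l, T (f l) (g l)) -> T (\sum_l a l *: f l) (\sum_l a l *: g l)) ->
  (forall f g f' g', T f g -> T f' g' -> T (f - f') (g - g')) ->
  (forall f g, T f g -> hom1 f <-> hom1 g) ->
  (forall f g, T f g -> hom2 m f <-> hom2 m g) ->
  irr_dim m M M' n -> irr_dim m N N' n.
Proof.
move=> Tf Tg Tlin Tsub T1 T2 [f [f1 fgen ffree]].
have /choice[g fg] l := Tf (f l); exists g; split.
- by move=> l; apply/(T1 _ _ (fg l)).
- move=> h; have [h' hh'] := Tg h => /(T1 _ _ hh')/fgen[a a2]; exists a.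
  by apply/(T2 _ _ (Tsub _ _ _ _ hh' (Tlin _ a _ _ fg))).
- by move=> a /(T2 _ _ (Tlin _ a _ _ fg))/ffree.
Qed.

Lemma irr_dim_syz M N M' N' n : stable M -> stable M' -> syz1 m M N -> syz1 m M' N' ->
  irr_dim m M M' n <-> irr_dim m N N' n.
Proof.
move=> Ms M's MN M'N'.
have Ns := stable_mod_syz noethA locm top mx xA Ms MN.
have N's := stable_mod_syz noethA locm top mx xA M's M'N'.
have [b [i [p [ip im]]]] := MN; have [b' [i' [p' [ip' i'm]]]] := M'N'.
have [M0 _ _] := Ms.
have down f := compatible_down ip ip' f.
have up g := compatible_up ip ip' g M0.
have h1 f g := hom1_compatible (f := f) (g := g) ip ip' Ms M's Ns N's.
have h2 f g : compatible i p i' p' f g -> hom2 m f <-> hom2 m g.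
  move=> fg; split; first exact: (hom2_down ip ip').
  exact: (hom2_up ip ip').
split; [apply: (irr_dim_transfer (T := compatible i p i' p')) |
        apply: (irr_dim_transfer (T := fun g f => compatible i p i' p' f g))] => //.
- by move=> k a f g fg; apply: compatible_lin.
- by move=> f g f' g'; apply: compatible_sub.
- by move=> k a f g fg; apply: compatible_lin.
- by move=> f g f' g'; apply: compatible_sub.
- by move=> f g /h1 ->.
- by move=> f g /h2 ->.
Qed.

End Irreducible.

(** * Higher syzygies *)

Section Resolutions.
Variables (A : comNzRingType) (m : set A).
Hypotheses (noethA : noetherian A) (locm : local_ring m).
Implicit Types M N K L : lmodType A.

Fixpoint syzn n M N : Prop :=
  if n is n'.+1 then exists K, syz1 m M K /\ syzn n' K N else isomorphic M N.

Lemma syzn_isol n M M' N : isomorphic M M' -> syzn n M N -> syzn n M' N.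
Proof.
move=> MM'; case: n => [|n] /=.
  exact: isomorphic_trans (isomorphic_sym MM').
by move=> [K [MK KN]]; exists K; split=> //; apply: syz1_isol MM' MK.
Qed.

Lemma syzn_isor n M N N' : isomorphic N N' -> syzn n M N -> syzn n M N'.
Proof.
move=> NN'; elim: n M => [|n IH] M /=; first by move/isomorphic_trans; apply.
by move=> [K [MK /IH KN]]; exists K.
Qed.

Lemma syzn_rcons n M K N : syzn n M K -> syz1 m K N -> syzn n.+1 M N.
Proof.
move=> MK KN; elim: n M MK => [|n IH] M /= => [MK|[L [ML LK]]].
  exists N; split; last exact: isomorphic_refl.
  exact: syz1_isol (isomorphic_sym MK) KN.
by exists L; split=> //; apply: IH.
Qed.

Lemma syzn_unique n M M' N N' : isomorphic M M' -> syzn n M N -> syzn n M' N' ->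
  isomorphic N N'.
Proof.
elim: n M M' => [|n IH] M M' /= MM'.
  move=> MN M'N'; apply: isomorphic_trans (isomorphic_sym MN) _.
  exact: isomorphic_trans MM' M'N'.
move=> [K [MK KN]] [K' [M'K' K'N']]; apply: (IH K K') => //.
exact: (syz1_unique noethA locm (syz1_isol MM' MK) M'K').
Qed.

Fact mulmxr_linear k n (D : 'M[A]_(k, n)) : linear (fun u : 'rV[A]_k => u *m D).
Proof. by move=> a u v; rewrite mulmxDl scalemxAl. Qed.
Definition mulmxr_lin k n (D : 'M[A]_(k, n)) : LinHom 'rV[A]_k 'rV[A]_n :=
  lin_of (mulmxr_linear D).

Lemma mulmx_max k n (D : 'M[A]_(k, n)) (u : 'rV[A]_k) :
  (forall r c, m (D r c)) -> max_ideal_mul m (u *m D).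
Proof.
move=> mD; apply/(max_ideal_mul_row (local_ideal locm)) => j.
rewrite mxE; apply: (submod_sum (M := A^o)) => [|l _].
  by apply/is_ideal_submod; apply: local_ideal.
exact: localM.
Qed.

Lemma row_space_module k n (D : 'M[A]_(k, n)) :
  exists (K : lmodType A) (g : LinHom K 'rV[A]_n),
    injective g /\ forall v, (exists y, v = g y) <-> (exists u, v = u *m D).
Proof.
have [K [g [gi _ gE]]] := submodule_exists noethA (fg_row A n) (submod_im (mulmxr_lin D)).
exists K, g; split=> // v; rewrite -gE.
by split=> [[u <-]|[u ->]]; exists u.
Qed.

(** The rows of [D] are minimal generators of [U]; minimality is expressed by the
    relations between them. *)
Lemma minimal_matrix n (U : set 'rV[A]_n) : submod (U : set ('rV[A]_n : lmodType A)) ->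
  exists k (D : 'M[A]_(k, n)), (forall v, U v <-> exists u, v = u *m D) /\
    (forall u : 'rV[A]_k, u *m D = 0 -> max_ideal_mul m u).
Proof.
move=> Us; have [K [i [ii Kfg iE]]] := submodule_exists noethA (fg_row A n) Us.
have [k [q [qs qm]]] := minimal_cover noethA locm Kfg.
have DE (u : 'rV[A]_k) : u *m (\matrix_j i (q (delta_mx 0 j))) = i (q u).
  rewrite -[RHS]/(lin_comp i q u) row_lin_sum; apply/rowP => j.
  by rewrite !mxE summxE; apply: eq_bigr => l _; rewrite !mxE.
exists k, (\matrix_j i (q (delta_mx 0 j))); split=> [v|u].
  split=> [/iE[y ->]|[u ->]]; first by have [u <-] := qs y; exists u; rewrite DE.
  by rewrite DE; apply/iE; exists (q u).
by rewrite DE => /(inj_ker0 ii)/qm.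
Qed.

Record sized_matrix := SizedMatrix {
  sm_rows : nat;
  sm_cols : nat;
  sm_mat : 'M[A]_(sm_rows, sm_cols) }.

(** Iterate the choice of minimal generators of the kernel of the last matrix. The
    number of columns of each matrix is by definition the number of rows of the
    previous one, so that the matrices compose without transport. *)
Lemma min_free_res_exists M : finitely_generated M -> inhabited (min_free_res m M).
Proof.
move=> Mfg; have [b [p [ps pm]]] := minimal_cover noethA locm Mfg.
have [c [D0 [D0E D0m]]] := minimal_matrix (submod_ker p).
have next_ex s : exists t : {k : nat & 'M[A]_(k, sm_rows s)},
    (forall v : 'rV[A]_(sm_rows s), v *m sm_mat s = 0 <-> exists u, v = u *m tagged t) /\
    (forall u : 'rV[A]_(tag t), u *m tagged t = 0 -> max_ideal_mul m u).
  have [k [D DP]] := minimal_matrix (submod_ker (mulmxr_lin (sm_mat s))).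
  by exists (existT _ k D).
pose next s := SizedMatrix (tagged (sval (cid (next_ex s)))).
have next_spec s : (forall v : 'rV[A]_(sm_rows s), v *m sm_mat s = 0 <->
      exists u : 'rV[A]_(sm_rows (next s)), v = u *m sm_mat (next s)) /\
    (forall u : 'rV[A]_(sm_rows (next s)), u *m sm_mat (next s) = 0 -> max_ideal_mul m u).
  exact: svalP (cid (next_ex s)).
pose st i := iter i next (SizedMatrix D0).
have st_max i (u : 'rV_(sm_rows (st i))) : u *m sm_mat (st i) = 0 -> max_ideal_mul m u.
  case: i u => [|i] u; first exact: D0m.
  exact: (next_spec (st i)).2.
have row_max i k (D : 'M[A]_(i, k)) :
    (forall u : 'rV[A]_i, max_ideal_mul m (u *m D)) -> forall r c, m (D r c).
  move=> Dm r j; have := (max_ideal_mul_row (local_ideal locm) _).1 (Dm (delta_mx 0 r)) j.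
  by rewrite -rowE mxE.
have st_exact i (v : 'rV[A]_(sm_rows (st i))) :
    v *m sm_mat (st i) = 0 <-> exists u, v = u *m sm_mat (st i.+1).
  exact: (next_spec (st i)).1.
split; apply: (@MinFreeRes A m M (fun i => sm_cols (st i)) (fun i => sm_mat (st i)) p) => //.
case=> [|i]; apply: row_max => u; first by apply: pm; apply/D0E; exists u.
by apply: st_max; apply/st_exact; exists u.
Qed.

(** The image of each differential is the first syzygy of the image of the previous
    one. *)
Lemma is_nat_syz_syzn n M N : finitely_generated M -> is_nat_syz m n M N -> syzn n M N.
Proof.
case: n => [//|i] Mfg [F [f [fi fE]]].
elim: i N f fi fE => [|i IH] N f fi fE.
  exists N; split; last exact: isomorphic_refl.
  exists (betti F 0), f, (aug F); split.
    split=> [//||v]; first by move=> y; have [v <-] := aug_surj F y; exists v.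
    split=> [/aug_exact/fE[y ->]|[y ->]]; first by exists y.
    by apply/aug_exact/fE; exists y.
  move=> y; have [u ->] : exists u, f y = u *m res_diff F 0 by apply/fE; exists y.
  by apply: mulmx_max; apply: res_minimal.
have [K [g [gi gE]]] := row_space_module (res_diff F i).
apply: syzn_rcons (IH K g gi gE) _.
have [|q qE] := factor_inj (g := mulmxr_lin (res_diff F i)) gi.
  by move=> u; apply/gE; exists u.
exists (betti F i.+1), f, q; split.
  split=> [//|y|v]; first by have /gE[u uE] : exists z, g y = g z by [exists y];
    exists u; apply: gi; rewrite qE uE.
  split=> [qv|[y ->]].
    by apply/fE/res_exact; rewrite -[LHS]/(mulmxr_lin (res_diff F i) v) -qE qv linear0.
  apply: gi; rewrite qE linear0; apply/res_exact/fE; by exists y.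
move=> y; have [u ->] : exists u, f y = u *m res_diff F i.+1 by apply/fE; exists y.
by apply: mulmx_max; apply: res_minimal.
Qed.

(** Conversely a minimal resolution exists, and its syzygies are the only ones up to
    isomorphism. *)
Lemma is_nat_syzP n M N : finitely_generated M -> is_nat_syz m n M N <-> syzn n M N.
Proof.
move=> Mfg; split; first exact: is_nat_syz_syzn.
case: n => [//|i] MN; have [F] := min_free_res_exists Mfg.
have [K [g [gi gE]]] := row_space_module (res_diff F i).
have MK : syzn i.+1 M K by apply: is_nat_syz_syzn => //; exists F, g.
have [h /bij_inverse[h' [hK h'K]]] := syzn_unique (isomorphic_refl M) MN MK.
exists F, (lin_comp g h); split; first exact: inj_comp gi (can_inj hK).
move=> v; rewrite -gE; split=> [[y ->]|[y ->]]; first by exists (h y).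
by exists (h' y); rewrite /= h'K.
Qed.

End Resolutions.

Section IntegerSyzygies.
Variables (A : comNzRingType) (m : set A) (R : coresolution (A^o : lmodType A)).
Variables (s : nat) (x : nat -> A).
Hypotheses (noethA : noetherian A) (locm : local_ring m).
Hypothesis top : forall N l, finitely_generated N -> (s < l)%N -> ext_zero R l N.
Hypotheses (mx : forall i, m (x i)) (xA : weakly_regular (A^o : lmodType A) x s).
Hypothesis dim : krull_dim A s.
Implicit Types M N K L : lmodType A.
Local Notation stable := (stable_mod m R).
Let stable_syz M N : stable M -> syz1 m M N -> stable N :=
  stable_mod_syz noethA locm top mx xA (M := M) (N := N).
Let stable_dual M : stable M -> stable (dual M) :=
  stable_mod_dual noethA locm top mx xA (M := M).

Lemma stable_fg M : stable M -> finitely_generated M.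
Proof. by move=> [[]]. Qed.

Lemma stable_syzn n M N : stable M -> syzn m n M N -> stable N.
Proof.
elim: n M => [|n IH] M Ms /=; first by move=> MN; apply: stable_mod_iso MN Ms.
by move=> [K [/(stable_syz Ms) Ks]]; apply: IH.
Qed.

Lemma syzn_dual n M N : stable M -> syzn m n M N -> syzn m n (dual N) (dual M).
Proof.
elim: n M => [|n IH] M Ms /=.
  by move=> MN; apply: dual_iso; apply: isomorphic_sym.
move=> [K [MK KN]]; apply: syzn_rcons (IH K (stable_syz Ms MK) KN) _.
exact: (stable_syz_dual locm Ms MK).
Qed.

(** Negative syzygies are read backwards; this agrees with the definition by duality
    on stable modules ([is_syzP]). *)
Definition syzZ (n : int) M N : Prop :=
  match n with
  | Posz i => syzn m i M N
  | Negz i => syzn m i.+1 N M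
  end.

Lemma is_syzP n M N : stable M -> stable N -> is_syz m n M N <-> syzZ n M N.
Proof.
have bd := stable_bidual noethA locm top mx xA.
case: n => i Ms Ns; first exact: is_nat_syzP (stable_fg Ms).
have dMs := stable_dual Ms; have nat := is_nat_syzP noethA locm i.+1 _ (stable_fg dMs).
split=> [[K [/nat MK NK]]|NM].
  apply: (syzn_isol (isomorphic_sym NK)).
  exact: syzn_isor (isomorphic_sym (bd _ Ms)) (syzn_dual dMs MK).
exists (dual N); split; last exact: bd.
by apply/nat; apply: syzn_dual NM.
Qed.

Lemma syzZ_isor n M N N' : isomorphic N N' -> syzZ n M N -> syzZ n M N'.
Proof. by case: n => i NN'; [apply: syzn_isor | apply: syzn_isol]. Qed.

Lemma syzZ_opp n M N : syzZ n M N -> syzZ (- n) N M.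
Proof. by case: n => [[|i]|i] //=; apply: isomorphic_sym. Qed.

Lemma syzZ_succ n M N L : syzZ n M N -> syz1 m N L -> syzZ (n + 1) M L.
Proof.
case: n => i MN NL; first by rewrite addrC -intS; apply: syzn_rcons MN NL.
have [K [NK KM]] := MN; have KL := syz1_unique noethA locm NK NL.
have {KM}LM := syzn_isol KL KM; rewrite NegzE intS opprD addrAC addNr add0r.
by case: i LM {MN} => [/isomorphic_sym|i].
Qed.

Lemma syzn_last n M N : syzn m n.+1 M N -> exists K, syzn m n M K /\ syz1 m K N.
Proof.
elim: n M => [|n IH] M [K [MK KN]].
  by exists M; split; [apply: isomorphic_refl | apply: syz1_isor KN MK].
by have [L [KL LN]] := IH K KN; exists L; split=> //; exists K.
Qed.

(** For [n > 0] this undoes the last syzygy, which is possible because a stable module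
    is determined by its syzygy. *)
Lemma syzZ_pred n M K L : stable M -> stable L -> syzZ n M K -> syz1 m L K ->
  syzZ (n - 1) M L.
Proof.
move=> Ms Ls; case: n => [[|i]|i].
- move=> /= MK LK; exists K; split=> //; exact: isomorphic_sym.
- move=> /syzn_last[K' [MK' K'K]] LK; rewrite intS addrC addKr.
  have K's := stable_syzn Ms MK'; apply: syzn_isor MK'.
  exact: (syz1_inj noethA locm top mx xA K's Ls K'K LK).
- move=> KM LK; rewrite NegzE -opprD -[_ + 1]PoszD addn1 -NegzE.
  by exists K.
Qed.

Lemma syzZ_add n k M N L : stable M -> stable L ->
  syzZ n M N -> syzZ k N L -> syzZ (n + k) M L.
Proof.
move=> Ms Ls MN; case: k => j.
  elim: j n N MN => [|j IH] n N MN /= => [NL|[K [NK KL]]].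
    by rewrite addr0; apply: syzZ_isor NL MN.
  by rewrite intS addrA; apply: IH KL; apply: syzZ_succ MN NK.
change (syzn m j.+1 L N -> syzZ (n + Negz j) M L); rewrite NegzE.
elim: (j.+1) L Ls => [|i IH] L Ls => [LN|[K [LK KN]]].
  by rewrite subr0; apply: syzZ_isor (isomorphic_sym LN) MN.
have Ks := stable_syz Ls LK; rewrite intS [1 + _]addrC opprD addrA.
by apply: syzZ_pred LK => //; apply: IH KN.
Qed.

Lemma syzZ_exists n M : stable M -> exists N, stable N /\ syzZ n M N.
Proof.
case: n => /= i Ms.
  elim: i M Ms => [|i IH] M Ms; first by exists M; split=> //; apply: isomorphic_refl.
  have [K [Ks MK]] := stable_syz_exists noethA locm top mx xA Ms.
  by have [N [Ns KN]] := IH K Ks; exists N; split=> //; exists K.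
suff [N [Ns NM]] : exists N, stable N /\ syzn m i.+1 N M by exists N.
elim: (i.+1) M Ms => [|l IH] M Ms; first by exists M; split=> //; apply: isomorphic_refl.
have [K [Ks KM]] := stable_cosyz_exists noethA locm top mx xA Ms.
have [N [Ns NK]] := IH K Ks; exists N; split=> //; exact: syzn_rcons NK KM.
Qed.

Lemma syzZ_unique n M M' N N' : stable M -> stable M' -> stable N -> stable N' ->
  isomorphic M M' -> syzZ n M N -> syzZ n M' N' -> isomorphic N N'.
Proof.
move=> Ms M's Ns N's MM' MN M'N'.
have NM' : syzZ (- n) N M' := syzZ_isor MM' (syzZ_opp MN).
by have := syzZ_add Ns N's NM' M'N'; rewrite addNr.
Qed.

(** ** Arrows *)

(** Isomorphic modules have the same syzygies. *)
Lemma irr_dim_iso M M' N N' n : stable M -> stable N -> isomorphic M M' ->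
  isomorphic N N' -> irr_dim m M N n -> irr_dim m M' N' n.
Proof.
move=> Ms Ns MM' NN'.
have [K [_ MK]] := stable_syz_exists noethA locm top mx xA Ms.
have [L [_ NL]] := stable_syz_exists noethA locm top mx xA Ns.
move=> /(irr_dim_syz noethA locm top mx xA dim n Ms Ns MK NL).
apply: (irr_dim_syz noethA locm top mx xA dim n _ _ (syz1_isol MM' MK)
  (syz1_isol NN' NL)).2; first exact: stable_mod_iso MM' Ms.
exact: stable_mod_iso NN' Ns.
Qed.

Lemma irr_dim_syzn k M N M' N' n : stable M -> stable N ->
  syzn m k M M' -> syzn m k N N' -> irr_dim m M N n <-> irr_dim m M' N' n.
Proof.
elim: k M N => [|k IH] M N Ms Ns /=.
  move=> MM' NN'; split; first exact: irr_dim_iso MM' NN'.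
  apply: irr_dim_iso (isomorphic_sym MM') (isomorphic_sym NN').
    exact: stable_mod_iso MM' Ms.
  exact: stable_mod_iso NN' Ns.
move=> [K [MK KM']] [L [NL LN']].
rewrite (irr_dim_syz noethA locm top mx xA dim n Ms Ns MK NL).
exact: (IH K L (stable_syz Ms MK) (stable_syz Ns NL)).
Qed.

Lemma irr_dim_syzZ k M N M' N' n : stable M -> stable N -> stable M' -> stable N' ->
  syzZ k M M' -> syzZ k N N' -> irr_dim m M N n -> irr_dim m M' N' n.
Proof.
case: k => i Ms Ns M's N's MM' NN'; first by apply: (irr_dim_syzn n Ms Ns MM' NN').1.
exact: (irr_dim_syzn n M's N's MM' NN').2.
Qed.

Lemma irr_dim_zero M N n : irr_dim m M N 0 -> irr_dim m M N n -> n = 0%N.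
Proof.
move=> [f0 [_ gen _]] [f [f1 _ free]]; case: n f f1 free => [//|n] f f1 free.
case: (local_proper locm); have [a] := gen (f ord0) (f1 ord0).
rewrite big_ord0 subr0 => f2.
have := free (fun j => (j == ord0)%:R); rewrite (bigD1 ord0) //= scale1r big1.
  by rewrite addr0 => /(_ f2 ord0).
by move=> j /negPf ->; rewrite scale0r.
Qed.

(** ** The stable Auslander-Reiten quiver *)

Local Notation vtx := (vertex (stable_AR_quiver m)).
Local Notation arrow := (fun v w : vtx => (0 < narrows v w)%N).
Local Notation represents v M := (sval (sval (v : vtx)) = iso_class M).

Lemma iso_classP M N : iso_class M = iso_class N <-> isomorphic M N.
Proof.
split=> [e|MN].
  by have : iso_class N N := isomorphic_refl N; rewrite -e.
apply: funext => K; apply: propext; split; first exact: isomorphic_trans (isomorphic_sym MN).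
exact: isomorphic_trans MN.
Qed.

Lemma vertex_stable v M : represents v M -> stable M.
Proof.
case: v => -[v [N [NMCM vE]] /= vA] vM; rewrite vE in vM.
have NM : isomorphic N M by apply/iso_classP.
apply: (stable_mod_iso NM); apply/(stable_modP noethA locm top mx xA dim); split=> //.
by move=> NA; apply: vA; rewrite vE; apply/iso_classP.
Qed.

Lemma vertex_represented v : exists M, represents v M.
Proof. by case: v => -[v [N [NMCM vE]] /= vA]; exists N. Qed.

Lemma stable_vertex M : stable M -> exists v, represents v M.
Proof.
move=> /(stable_modP noethA locm top mx xA dim)[MMCM MA].
pose v : AR_vertex m := exist _ (iso_class M) (ex_intro _ M (conj MMCM erefl)).
have vA : ~ sval v = iso_class (A^o : lmodType A) by move=> /iso_classP.
by exists (exist _ v vA).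
Qed.

Lemma represents_inj v w M N : represents v M -> represents w N -> isomorphic M N -> v = w.
Proof.
move=> vM wN /iso_classP MN; move: v w vM wN.
move=> [[v v1] v2] [[w w1] w2] /= vM wN; do 2 apply: eq_exist.
by rewrite vM wN.
Qed.

Lemma represents_iso v M N : represents v M -> represents v N -> isomorphic M N.
Proof. by move=> vM vN; apply/iso_classP; rewrite -vM -vN. Qed.

(** The number of arrows is one of the dimensions found for representatives of the two
    vertices; these dimensions vanish together. *)
Lemma arrow_syzZ k v w v' w' M N M' N' :
  represents v M -> represents w N -> represents v' M' -> represents w' N' ->
  syzZ k M M' -> syzZ k N N' -> arrow v w -> arrow v' w'.
Proof.
move=> vM wN v'M' w'N' MM' NN'.
have [Ms Ns] := (vertex_stable vM, vertex_stable wN).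
have [M's N's] := (vertex_stable v'M', vertex_stable w'N').
rewrite /= /AR_narrows; case: xgetP => [n _ [M0 [N0 [vM0 wN0 irr]]]|] // n_gt0.
have irr' : irr_dim m M' N' n.
  apply: (irr_dim_syzZ Ms Ns M's N's MM' NN').
  rewrite vM in vM0; rewrite wN in wN0.
  apply: (irr_dim_iso _ _ (isomorphic_sym vM0) (isomorphic_sym wN0) irr).
    exact: stable_mod_iso vM0 Ms.
  exact: stable_mod_iso wN0 Ns.
case: xgetP => [n' _ [M1 [N1 [v'M1 w'N1 irr1]]]|/(_ n)[]]; last first.
  by exists M', N'; rewrite v'M' w'N'; split=> //; apply: isomorphic_refl.
rewrite lt0n; apply/eqP => n'0; rewrite n'0 in irr1.
rewrite v'M' in v'M1; rewrite w'N' in w'N1.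
have irr0 : irr_dim m M' N' 0.
  apply: (irr_dim_iso _ _ (isomorphic_sym v'M1) (isomorphic_sym w'N1) irr1).
    exact: stable_mod_iso v'M1 M's.
  exact: stable_mod_iso w'N1 N's.
by rewrite (irr_dim_zero irr0 irr') in n_gt0.
Qed.

Local Notation connected := (clos_refl_sym_trans vtx arrow).

(** Syzygies move a path to a path: follow the representatives of its vertices. *)
Lemma connected_syzZ k v w : connected v w -> forall v' w' M N M' N',
  represents v M -> represents w N -> represents v' M' -> represents w' N' ->
  syzZ k M M' -> syzZ k N N' -> connected v' w'.
Proof.
elim=> {v w} [v w vw|v|v w _ IH|v u w _ IHvu _ IHuw] v' w' M N M' N' vM wN v'M' w'N' MM' NN'.
- by apply: rst_step; apply: arrow_syzZ vM wN v'M' w'N' MM' NN' vw.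
- suff -> : v' = w' by apply: rst_refl.
  apply: (represents_inj v'M' w'N').
  apply: (syzZ_unique _ _ _ _ (represents_iso vM wN) MM' NN').
  - exact: vertex_stable vM.
  - exact: vertex_stable wN.
  - exact: vertex_stable v'M'.
  - exact: vertex_stable w'N'.
- by apply: rst_sym; apply: IH wN vM w'N' v'M' NN' MM'.
have [K uK] := vertex_represented u.
have [K' [K's KK']] := syzZ_exists k (vertex_stable uK).
have [u' u'K'] := stable_vertex K's.
by apply: rst_trans (IHvu _ _ _ _ _ _ vM uK v'M' u'K' MM' KK')
  (IHuw _ _ _ _ _ _ uK wN u'K' w'N' KK' NN').
Qed.

Variable C : vtx -> Prop.
Hypothesis C_component : connected_component C.

Lemma component_connected v w : C v -> C w -> connected v w.
Proof.
by have [u uC] := C_component => /uC uv /uC uw; apply: rst_trans uw; apply: rst_sym.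
Qed.

Lemma connected_component_in v w : C v -> connected v w -> C w.
Proof. by have [u uC] := C_component => /uC uv vw; apply/uC; apply: rst_trans vw. Qed.

Lemma in_component_stable M : in_component C M -> stable M.
Proof. by move=> [v [_ vM]]; apply: vertex_stable vM. Qed.

Lemma syz_indexP M n : stable M ->
  syz_index C M n <-> exists N, syzZ n M N /\ in_component C N.
Proof.
move=> Ms; split=> -[N [MN CN]]; exists N; split=> //; have Ns := in_component_stable CN;
  exact/(is_syzP n Ms Ns).
Qed.

(** The [n]-th syzygies of the vertices of a path from [M] to [N] form a path from the
    [n]-th syzygy of [M] to that of [N]. *)
Lemma syz_index_sub M N n : in_component C M -> in_component C N ->
  syz_index C M n -> syz_index C N n.
Proof.
move=> CM CN; have [Ms Ns] := (in_component_stable CM, in_component_stable CN).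
move=> /(syz_indexP n Ms)[M' [MM' [v' [Cv' v'M']]]]; apply/(syz_indexP n Ns).
have [N' [N's NN']] := syzZ_exists n Ns; exists N'; split=> //.
have [w' w'N'] := stable_vertex N's; exists w'; split=> //.
have [[v [Cv vM]] [w [Cw wN]]] := (CM, CN).
apply: connected_component_in Cv' _.
exact: connected_syzZ (component_connected Cv Cw) _ _ _ _ _ _ vM wN v'M' w'N' MM' NN'.
Qed.

(** If the [n]-th syzygy [N] of [M] is in the component, then [N] has the same set of
    indices as [M]; it contains [-n], and adding [n] to it stays in that of [M]. *)
Lemma syz_index_ideal M : in_component C M -> is_ideal (syz_index C M).
Proof.
move=> CM; have Ms := in_component_stable CM.
have I0 : syz_index C M 0.
  by apply/(syz_indexP _ Ms); exists M; split=> //; apply: isomorphic_refl.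
have ID n k : syz_index C M n -> syz_index C M k -> syz_index C M (n + k).
  move=> /(syz_indexP _ Ms)[N [MN CN]] /(syz_index_sub CM CN).
  have Ns := in_component_stable CN => /(syz_indexP _ Ns)[L [NL CL]].
  apply/(syz_indexP _ Ms); exists L; split=> //.
  exact: syzZ_add (in_component_stable CL) MN NL.
have IN n : syz_index C M n -> syz_index C M (- n).
  move=> /(syz_indexP _ Ms)[N [MN CN]]; apply: (syz_index_sub CN CM).
  apply/(syz_indexP _ (in_component_stable CN)); exists M; split=> //.
  exact: syzZ_opp.
have IM (k : nat) n : syz_index C M n -> syz_index C M (k%:Z * n).
  move=> In; elim: k => [|k IH]; first by rewrite mul0r.
  by rewrite intS mulrDl mul1r; apply: ID.
split=> // -[k|k] n In; first exact: IM.
by rewrite NegzE mulNr; apply/IN/IM.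
Qed.

End IntegerSyzygies.

Theorem theorem1p13 (A : comNzRingType) (m : set A) (k : fieldType)
    (pi : {rmorphism A -> k})
    (A_gorenstein : gorenstein_local_ring m)
    (A_complete : adically_complete m)
    (A_residue_field : residue_field m pi)
    (k_closed : GRing.closed_field_axiom k)
    (A_equicharacteristic : equicharacteristic A k)
    (A_isolated : isolated_singularity m)
    (A_not_finite_type : ~ finite_representation_type m)
    (C : vertex (stable_AR_quiver m) -> Prop)
    (C_component : connected_component C) :
  (forall M : lmodType A, in_component C M -> is_ideal (syz_index C M)) /\
  (forall M N : lmodType A, in_component C M -> in_component C N ->
     syz_index C N = syz_index C M).
Proof.
have [noethA locm _] := A_gorenstein.
have [R [s [x [top mx xA]]]] := gorenstein_depth A_gorenstein.
have [v0 _] := C_component.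
have dim : krull_dim A s.
  have [_ [M [[MMCM _] _]]] := sval v0.
  by have [] := MCM_acyclic noethA locm top mx xA MMCM.
split=> [M|M N CM CN].
  exact: (syz_index_ideal noethA locm top mx xA dim C_component).
apply/seteqP; split=> n.
  exact: (syz_index_sub noethA locm top mx xA dim C_component).
exact: (syz_index_sub noethA locm top mx xA dim C_component).
Qed.
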